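(* Let $m\ge 2$ be a natural number, let $X$ be an (infinite-dimensional) $\mathcal{L}_\infty$-space and let $q>0$. Then $\mathcal{P}_{as(q;2)}(^mX)=\mathcal{P}(^mX)$ if and only if $q\ge 1$.
   Context: The scalar field $\mathbb{K}$ is either $\mathbb{R}$ or $\mathbb{C}$. $\mathcal{L}_\infty$-spaces are meant in the sense of Lindenstrauss and Pełczyński, and are always assumed infinite-dimensional. $\mathcal{P}(^mX)$ is the Banach space of continuous $m$-homogeneous polynomials $P:X\to\mathbb{K}$. For a finite sequence $(x_j)_{j=1}^k$ in $X$ and $r>0$, $\|(x_j)_{j=1}^k\|_{w,r}=\sup_{\varphi\in B_{X'}}\left(\sum_{j=1}^k|\varphi(x_j)|^r\right)^{1/r}$, where $B_{X'}$ is the closed unit ball of the dual $X'$. A continuous $m$-homogeneous polynomial $P:X\to\mathbb{K}$ is absolutely $(p;r)$-summing if there is a constant $L\ge 0$ such that $\left(\sum_{j=1}^k|P(x_j)|^p\right)^{1/p}\le L\,\|(x_j)_{j=1}^k\|_{w,r}^m$ for every $k\in\mathbb{N}$ and all $x_1,\dots,x_k\in X$; the space of these is $\mathcal{P}_{as(p;r)}(^mX)$. (The notion is of interest for $p\ge r/m$; for $p<r/m$ only the zero polynomial satisfies the inequality.) *)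

(* Defs.v *)
From HB Require Import structures.
From mathcomp Require Import all_boot all_order all_algebra.
From mathcomp Require Import complex.
From mathcomp Require Import all_classical all_reals all_analysis.
Set Implicit Arguments.
Unset Strict Implicit.
Unset Printing Implicit Defensive.
Import Order.TTheory GRing.Theory Num.Theory.
Import numFieldNormedType.Exports.
Local Open Scope classical_set_scope.
Local Open Scope ring_scope.

Variant scalar_kind := RealScalars | ComplexScalars.

Definition scalar_field (R : realType) (s : scalar_kind) : numFieldType :=
  match s with
  | RealScalars => (R : numFieldType)
  | ComplexScalars => (R[i] : numFieldType)
  end.

Definition realpart (R : realType) (s : scalar_kind) :
    scalar_field R s -> R :=
  match s with
  | RealScalars => fun x => x
  | ComplexScalars => fun z => complex.Re z
  end.

(* The norm of a normedModType K takes its values in K, also for K = R[i].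
   These values are nonnegative reals, and real powers, suprema and infima are
   taken after moving them to R. *)
Definition rnorm (R : realType) (s : scalar_kind)
  (V : normedModType (scalar_field R s)) (v : V) : R := realpart `|v|.

Section Definitions.
Variables (R : realType) (s : scalar_kind).
Local Notation K := (scalar_field R s).

Definition opnorm (V W : normedModType K) (f : V -> W) : \bar R :=
  ereal_sup [set (rnorm (f v))%:E | v in [set v : V | rnorm v <= 1]].

(* For an injective linear f, the operator norm of the inverse of f, defined
   on the range of f. *)
Definition inv_opnorm (V W : normedModType K) (f : V -> W) : \bar R :=
  ereal_sup [set (rnorm v)%:E | v in [set v : V | rnorm (f v) <= 1]].

Definition lspan (X : lmodType K) (n : nat) (b : 'I_n -> X) : set X :=
  [set \sum_(i < n) a i *: b i | a in [set: 'I_n -> K]].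

Definition finite_dim_subspace (X : lmodType K) (E : set X) : Prop :=
  exists (n : nat) (b : 'I_n -> X), E = lspan b.

Definition infinite_dimensional (X : lmodType K) : Prop :=
  ~ finite_dim_subspace [set: X].

(* Banach-Mazur distance between l_infty^n and a subspace F of X. The norm of
   'rV[K]_n is the maximum norm. The distance is +oo when there is no linear
   isomorphism, so finiteness forces n = dim F. *)
Definition banach_mazur_linfty (X : normedModType K) (n : nat) (F : set X) :
    \bar R :=
  ereal_inf [set (opnorm T * inv_opnorm T)%E |
    T in [set T : {linear 'rV[K]_n -> X} | injective T /\ range T = F]].

Definition script_Linfty_space (X : completeNormedModType K) : Prop :=
  exists2 lambda : R, 1 <= lambda &
    forall E : set X, finite_dim_subspace E ->
      exists F : set X, [/\ finite_dim_subspace F, E `<=` F &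
        exists n : nat, (banach_mazur_linfty n F <= lambda%:E)%E].

Definition multilinear (m : nat) (X : lmodType K) (A : ('I_m -> X) -> K^o) :
    Prop :=
  forall (i : 'I_m) (x : 'I_m -> X),
    linear (fun u : X => A (fun j => if j == i then u else x j)).

(* The space P(^m X): continuity is required of P, not of the multilinear map A
   inducing it. *)
Definition homogeneous_polynomials (m : nat) (X : normedModType K) :
    set (X -> K^o) :=
  [set P | (exists2 A : ('I_m -> X) -> K^o, multilinear A &
              forall x : X, P x = A (fun=> x))
           /\ continuous P].
Arguments homogeneous_polynomials : clear implicits.

Definition dual_unit_ball (X : normedModType K) : set {linear X -> K^o} :=
  [set phi : {linear X -> K^o} | continuous phi /\ (opnorm phi <= 1)%E].
Arguments dual_unit_ball : clear implicits.

(* The supremum is always finite: opnorm phi <= 1 bounds |phi (x j)| by the norm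
   of x j. *)
Definition weak_norm (X : normedModType K) (r : R) (k : nat) (x : 'I_k -> X) :
    \bar R :=
  ereal_sup [set ((\sum_(j < k) rnorm (phi (x j)) `^ r) `^ r^-1)%:E |
    phi in dual_unit_ball X].

(* P_as(p;r)(^m X) *)
Definition as_polynomials (p r : R) (m : nat) (X : normedModType K) :
    set (X -> K^o) :=
  [set P | homogeneous_polynomials m X P /\
    exists2 L : R, 0 <= L & forall (k : nat) (x : 'I_k -> X),
      (((\sum_(j < k) rnorm (P (x j)) `^ p) `^ p^-1)%:E
        <= L%:E * weak_norm r x ^+ m)%E].

Arguments as_polynomials : clear implicits.

End Definitions.

Arguments dual_unit_ball {R s} X.
Arguments homogeneous_polynomials {R s} m X.
Arguments as_polynomials {R s} p r m X.

(* Main.v *)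
Require Import Defs.
From HB Require Import structures.
From mathcomp Require Import all_boot all_order all_algebra.
From mathcomp Require Import complex ring lra.
From mathcomp Require Import all_classical all_reals all_analysis.
Set Implicit Arguments.
Unset Strict Implicit.
Unset Printing Implicit Defensive.
Import Order.TTheory GRing.Theory Num.Theory.
Import numFieldNormedType.Exports.
Local Open Scope classical_set_scope.
Local Open Scope ring_scope.

(* Sufficiency. The span of [x_1 .. x_k] lies in a copy of [l_infty^n] with
   constants independent of [n], and by Hahn-Banach the coordinates of the [x_j]
   have l2 columns bounded by [C * weak_norm 2 x].  Over the reals (in the complex
   case after splitting coordinates into real and imaginary parts) Grothendieck's
   inequality bounds [\sum_j |B (x_j, y_j)|] for bilinear [B]; applying it once
   more for each further argument gives the same for m-linear forms, and
   polarization passes from the polynomial to a bounded m-linear form.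
   Necessity. On a copy of [l_infty^n] with coordinates [t_i] and basis [x_j],
   the polynomial [n^-1 * \sum_i t_i ^ m] is bounded independently of [n], while
   [weak_norm 2 x <= 1] and the q-th powers of its values at the [x_j] sum to
   [n^(1-q)].  If [q < 1], a gliding hump sums such polynomials to one that is
   not (q;2)-summing. *)

(** * Grothendieck's inequality *)

(** Why the exponent is 2: for each coordinate [a], Grothendieck's inequality sees the vector of
    [a]-th coordinates of [x_1, .., x_k] as one point of l2^k. Scalars of modulus at most 1 can be
    moved into one argument without enlarging these vectors; this absorbs absolute values and makes
    the iteration over further arguments possible. The outcome is an l1 bound, and [q >= 1] enters
    only through the domination of the lq norm by the l1 norm. Hahn-Banach is needed because the
    weak norm tests against functionals on all of [X], while coordinates are given only on the copy
    of l_infty^n. For necessity, the hypothesis yields one summing constant per polynomial and no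
    uniform bound. The hump needs none: each partial sum is itself a continuous polynomial, so its
    own constant is available before the next block is chosen, and a block of dimension [n] and
    coefficient [c] contributes about [(c/3)^q * n^(1-q)], which can be made to outweigh it. *)

Section Rademacher.
Variable R : realType.

(** Expectation for the uniform distribution; over [signs I] the functions [sgn w i] become
    independent Rademacher variables. On an empty type the value is [0]. *)
Definition mean (T : finType) (F : T -> R) : R := (\sum_w F w) / #|T|%:R.

Lemma eq_mean (T : finType) (F G : T -> R) : F =1 G -> mean F = mean G.
Proof. by move=> FG; rewrite /mean (eq_bigr _ (fun w _ => FG w)). Qed.

Lemma meanD (T : finType) (F G : T -> R) :
  mean (fun w => F w + G w) = mean F + mean G.
Proof. by rewrite /mean big_split mulrDl. Qed.

Lemma meanZ (T : finType) (a : R) (F : T -> R) :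
  mean (fun w => a * F w) = a * mean F.
Proof. by rewrite /mean -mulr_sumr mulrA. Qed.

Lemma mean_sum (T I : finType) (F : I -> T -> R) :
  mean (fun w => \sum_i F i w) = \sum_i mean (F i).
Proof. by rewrite /mean exchange_big mulr_suml. Qed.

Lemma le_mean (T : finType) (F G : T -> R) :
  (forall w, F w <= G w) -> mean F <= mean G.
Proof. by move=> FG; rewrite ler_wpM2r ?invr_ge0 ?ler0n// ler_sum. Qed.

Lemma mean_const (T : finType) (a : R) : (0 < #|T|)%N -> mean (fun=> a : R) (T := T) = a.
Proof.
move=> T0; rewrite /mean sumr_const -[a *+ _]mulr_natr mulfK//.
by rewrite pnatr_eq0 -lt0n.
Qed.

Local Notation signs I := {ffun I -> bool}.

Lemma card_signs_gt0 (I : finType) : (0 < #|{: signs I}|)%N.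
Proof. by apply/card_gt0P; exists [ffun=> true]. Qed.

Definition sgn (I : finType) (w : signs I) (i : I) : R := (-1) ^+ w i.

Lemma sgn_sqr (I : finType) (w : signs I) i : sgn w i ^+ 2 = 1.
Proof. by rewrite /sgn sqrr_sign. Qed.

Lemma normr_sgn (I : finType) (w : signs I) i : `|sgn w i| = 1.
Proof. by rewrite /sgn normr_sign. Qed.

Definition flip (I : finType) (i : I) (w : signs I) : signs I :=
  [ffun j => (j == i) (+) w j].

Lemma flipK (I : finType) (i : I) : involutive (flip i).
Proof. by move=> w; apply/ffunP => j; rewrite !ffunE addbA addbb. Qed.

Lemma sgn_flip (I : finType) (i j : I) (w : signs I) :
  sgn (flip i w) j = (-1) ^+ (j == i) * sgn w j.
Proof. by rewrite /sgn ffunE signr_addb. Qed.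

Lemma mean_flip (I : finType) (i : I) (F : signs I -> R) :
  mean (fun w => F (flip i w)) = mean F.
Proof.
rewrite /mean; congr (_ / _); rewrite [RHS](reindex_inj (inv_inj (flipK i))).
exact: eq_bigr.
Qed.

(** Flipping one sign preserves the uniform distribution, so the mean equals its own opposite. *)
Lemma mean_odd (I : finType) (i : I) (F : signs I -> R) :
  (forall w, F (flip i w) = - F w) -> mean F = 0.
Proof.
move=> oddF; have := mean_flip i F.
rewrite (eq_mean (G := fun w => -1 * F w)) => [|w]; last by rewrite oddF mulN1r.
by rewrite meanZ mulN1r => /eqP; rewrite eq_sym -addr_eq0 -mulr2n mulrn_eq0 => /eqP.
Qed.

Lemma mean_sgnM (I : finType) (i j : I) :
  mean (fun w : signs I => sgn w i * sgn w j) = (i == j)%:R.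
Proof.
have [<-|ij] := eqVneq i j.
  rewrite (eq_mean (G := fun=> 1)) => [|w]; last by rewrite -expr2 sgn_sqr.
  by rewrite mean_const// card_signs_gt0.
apply: (@mean_odd _ i) => w; rewrite !sgn_flip eqxx eq_sym (negbTE ij).
by rewrite expr1 expr0; ring.
Qed.

(** Rademacher sums embed l2 isometrically into L2 of the sign vectors, so scalar products become
    means of products of scalars. *)
Lemma mean_rademacherM (I : finType) (x y : I -> R) :
  mean (fun w : signs I => (\sum_i sgn w i * x i) * (\sum_i sgn w i * y i)) =
  \sum_i x i * y i.
Proof.
rewrite (eq_mean (G := fun w => \sum_i \sum_j x i * y j * (sgn w i * sgn w j))).
  rewrite mean_sum; apply: eq_bigr => i _; rewrite mean_sum (bigD1 i)//=.
  rewrite meanZ mean_sgnM eqxx mulr1 big1 ?addr0// => j ji.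
  by rewrite meanZ mean_sgnM eq_sym (negbTE ji) mulr0.
move=> w; rewrite mulr_suml; apply: eq_bigr => i _.
by rewrite mulr_sumr; apply: eq_bigr => j _; ring.
Qed.

(** Khintchine's inequality for the fourth moment. It controls the tail left by truncation. *)
Lemma rademacher_moment4 (I : finType) (x : I -> R) :
  mean (fun w : signs I => (\sum_i sgn w i * x i) ^+ 4) <=
  3 * (\sum_i x i ^+ 2) ^+ 2.
Proof.
(* The second moment is carried through the induction because it occurs in the mixed term
   [6 * x i ^+ 2 * mean (U ^+ 2)]. *)
suff H r : uniq r ->
    mean (fun w : signs I => (\sum_(i <- r) sgn w i * x i) ^+ 2)
      = \sum_(i <- r) x i ^+ 2 /\
    mean (fun w : signs I => (\sum_(i <- r) sgn w i * x i) ^+ 4)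
      <= 3 * (\sum_(i <- r) x i ^+ 2) ^+ 2.
  by have [_] := H _ (index_enum_uniq I).
elim: r => [_|i r IH /= /andP[ir /IH[IH2 IH4]]].
  rewrite big_nil; split; under eq_mean do rewrite big_nil expr0n.
    by rewrite mean_const// card_signs_gt0.
  by rewrite mean_const ?card_signs_gt0// expr0n mulr0.
set U := fun w : signs I => \sum_(j <- r) sgn w j * x j.
have Uflip w : U (flip i w) = U w.
  rewrite /U !big_seq; apply: eq_bigr => j jr; rewrite sgn_flip.
  by case: eqP => [ji|_]; [rewrite -ji jr in ir|rewrite expr0 mul1r].
(* Pairing [w] with [flip i w] cancels the odd powers of the [i]-th term. *)
have avg (F G : signs I -> R) : (forall w, F w + F (flip i w) = 2 * G w) -> mean F = mean G.
  move=> FG; have := meanD F (fun w => F (flip i w)).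
  by rewrite (eq_mean FG) meanZ mean_flip => H; lra.
have U2 : mean (fun w => (sgn w i * x i + U w) ^+ 2) = x i ^+ 2 + mean (fun w => U w ^+ 2).
  rewrite -[X in X + _](mean_const _ (card_signs_gt0 I)) -meanD; apply: avg => w.
  rewrite Uflip sgn_flip eqxx expr1.
  transitivity (2 * (sgn w i ^+ 2 * x i ^+ 2 + U w ^+ 2)); first by ring.
  by rewrite sgn_sqr mul1r.
have U4 : mean (fun w => (sgn w i * x i + U w) ^+ 4) =
    x i ^+ 4 + 6 * x i ^+ 2 * mean (fun w => U w ^+ 2) + mean (fun w => U w ^+ 4).
  rewrite -[x i ^+ 4](mean_const _ (card_signs_gt0 I)) -meanZ -!meanD; apply: avg => w.
  rewrite Uflip sgn_flip eqxx expr1.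
  have s2 := sgn_sqr w i; have s4 : sgn w i ^+ 4 = 1 by rewrite (exprM _ 2 2) s2 expr1n.
  transitivity (2 * (sgn w i ^+ 4 * x i ^+ 4 +
    6 * (sgn w i ^+ 2 * x i ^+ 2) * U w ^+ 2 + U w ^+ 4)).
    by ring.
  by rewrite s2 s4; ring.
have -> : (fun w : signs I => (\sum_(j <- i :: r) sgn w j * x j) ^+ 2) =
          (fun w => (sgn w i * x i + U w) ^+ 2) by apply/funext => w; rewrite big_cons.
have -> : (fun w : signs I => (\sum_(j <- i :: r) sgn w j * x j) ^+ 4) =
          (fun w => (sgn w i * x i + U w) ^+ 4) by apply/funext => w; rewrite big_cons.
rewrite U2 U4 !big_cons IH2; split => //.
move: IH4; rewrite -/U; set m4 := mean _; set S := \sum_(_ <- _) _ => IH4.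
have -> : x i ^+ 4 = (x i ^+ 2) ^+ 2 by rewrite -exprM.
(* The right side exceeds the left by at least [2 * x i ^+ 4]. *)
by have := sqr_ge0 (x i ^+ 2); nra.
Qed.

Definition trunc (M u : R) : R := if `|u| <= M then u else 0.

Lemma normr_trunc (M u : R) : 0 <= M -> `|trunc M u| <= M.
Proof. by move=> M0; rewrite /trunc; case: ifPn => // _; rewrite normr0. Qed.

Lemma trunc_sqr_le (M u : R) : trunc M u ^+ 2 <= u ^+ 2.
Proof. by rewrite /trunc; case: ifPn => // _; rewrite expr0n sqr_ge0. Qed.

(** Where the difference is nonzero it equals [u] with [|u| > M], and there [M ^+ 2 <= u ^+ 2]. *)
Lemma trunc_tail (M u : R) : 0 < M -> (u - trunc M u) ^+ 2 <= u ^+ 4 / M ^+ 2.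
Proof.
move=> M0; rewrite /trunc; case: ifPn => [_|].
  by rewrite subrr expr0n divr_ge0// ?sqr_ge0// (exprM _ 2 2) sqr_ge0.
rewrite -ltNge subr0 => uM; rewrite ler_pdivlMr ?exprn_gt0//.
have -> : u ^+ 4 = u ^+ 2 * u ^+ 2 by rewrite -exprD.
rewrite ler_wpM2l ?sqr_ge0// -[leRHS]ger0_norm ?sqr_ge0// normrX.
by rewrite lerXn2r ?nnegrE ?(ltW M0)//; exact: ltW.
Qed.

End Rademacher.

Section Grothendieck.
Variables (R : realType) (I J : finType) (b : I -> J -> R).

(** The extension of the bilinear form [b] to Hilbert-space arguments. The index type [N] is
    arbitrary since sign vectors will serve as indices too. *)
Definition hform (N : finType) (x : I -> N -> R) (y : J -> N -> R) : R :=
  \sum_i \sum_j b i j * \sum_k x i k * y j k.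

Lemma hformDl (N : finType) (x x' : I -> N -> R) (y : J -> N -> R) :
  hform (fun i k => x i k + x' i k) y = hform x y + hform x' y.
Proof.
rewrite -big_split; apply: eq_bigr => i _; rewrite -big_split.
apply: eq_bigr => j _; rewrite /= -mulrDr -big_split; congr (_ * _).
by apply: eq_bigr => k _; rewrite mulrDl.
Qed.

Lemma hformDr (N : finType) (x : I -> N -> R) (y y' : J -> N -> R) :
  hform x (fun j k => y j k + y' j k) = hform x y + hform x y'.
Proof.
rewrite -big_split; apply: eq_bigr => i _; rewrite -big_split.
apply: eq_bigr => j _; rewrite /= -mulrDr -big_split; congr (_ * _).
by apply: eq_bigr => k _; rewrite mulrDr.
Qed.

Lemma hformZ (N : finType) (x : I -> N -> R) (y : J -> N -> R) (a c : R) :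
  hform (fun i k => a * x i k) (fun j k => c * y j k) = a * c * hform x y.
Proof.
rewrite mulr_sumr; apply: eq_bigr => i _; rewrite mulr_sumr.
apply: eq_bigr => j _; rewrite [RHS]mulrCA; congr (_ * _).
by rewrite mulr_sumr; apply: eq_bigr => k _; ring.
Qed.

Definition l2ball (H : Type) (N : finType) (x : H -> N -> R) :=
  forall i, \sum_k x i k ^+ 2 <= 1.

(** All dimensions are taken together: the Rademacher embedding leads from l2^N to a space of
    dimension 2^N, and the resulting values must still be bounded by the same supremum. *)
Definition hform_values : set R :=
  [set r | exists (N : nat) (x : I -> 'I_N -> R) (y : J -> 'I_N -> R),
    [/\ l2ball x, l2ball y & r = hform x y]].

(** This crude bound, dependent on the size of [b], makes the supremum [S] finite, so that
    [S <= 49 * D + S / 2] can be solved for [S]. *)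
Lemma hform_values_ub : ubound hform_values (\sum_i \sum_j `|b i j|).
Proof.
move=> _ [N [x [y [bx By ->]]]]; apply: ler_sum => i _; apply: ler_sum => j _.
apply: le_trans (ler_norm _) _; rewrite normrM ler_piMr//.
apply: le_trans (ler_norm_sum _ _ _) _.
apply: (@le_trans _ _ (\sum_k 2^-1 * (x i k ^+ 2 + y j k ^+ 2))).
  apply: ler_sum => k _; rewrite normrM -(real_normK (num_real (x i k))).
  rewrite -(real_normK (num_real (y j k))).
  by have := sqr_ge0 (`|x i k| - `|y j k|); nra.
rewrite -mulr_sumr big_split/=; have := bx i; have := By j; lra.
Qed.

Lemma hform_le_sup (N : finType) (x : I -> N -> R) (y : J -> N -> R) (a c : R) :
  0 < a -> 0 < c ->
  (forall i, \sum_k x i k ^+ 2 <= a ^+ 2) ->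
  (forall j, \sum_k y j k ^+ 2 <= c ^+ 2) ->
  hform x y <= a * c * sup hform_values.
Proof.
move=> a0 c0 xa yc.
have -> : hform x y = a * c * hform (fun i k => a^-1 * x i k) (fun j k => c^-1 * y j k).
  rewrite hformZ; have := lt0r_neq0 a0; have := lt0r_neq0 c0 => ? ?.
  by field; apply/andP.
rewrite ler_pM2l ?mulr_gt0//; apply: ub_le_sup.
  by exists (\sum_i \sum_j `|b i j|); exact: hform_values_ub.
exists #|N|, (fun i k => a^-1 * x i (enum_val k)), (fun j k => c^-1 * y j (enum_val k)).
have reix (F : N -> R) : \sum_k F k = \sum_(k < #|N|) F (enum_val k).
  rewrite (reindex (@enum_val N N))//=.
  by apply: onW_bij; exact: enum_val_bij.
split=> [i|j|]; rewrite ?/hform.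
- rewrite -(reix (fun k => (a^-1 * x i k) ^+ 2)).
  under eq_bigr do rewrite exprMn; rewrite -mulr_sumr exprVn.
  by rewrite ler_pdivrMl ?exprn_gt0// mulr1.
- rewrite -(reix (fun k => (c^-1 * y j k) ^+ 2)).
  under eq_bigr do rewrite exprMn; rewrite -mulr_sumr exprVn.
  by rewrite ler_pdivrMl ?exprn_gt0// mulr1.
- apply: eq_bigr => i _; apply: eq_bigr => j _; congr (_ * _).
  by rewrite (reix (fun k => a^-1 * x i k * (c^-1 * y j k))).
Qed.

(* With [S] the best constant over all l2^N, write [<x, y>] as the mean of the
   product of two Rademacher sums and truncate both at 7.  The truncated parts
   contribute at most [49 * D], and each of the two remainders at most [S / 4],
   since a tail has L2 norm at most [sqrt 3 / 7 < 1 / 4]. *)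
Theorem grothendieck_inequality (D : R) :
  (forall (u : I -> R) (v : J -> R), (forall i, `|u i| <= 1) ->
    (forall j, `|v j| <= 1) -> \sum_i \sum_j b i j * (u i * v j) <= D) ->
  forall (N : nat) (x : I -> 'I_N -> R) (y : J -> 'I_N -> R),
    l2ball x -> l2ball y -> hform x y <= 98 * D.
Proof.
move=> bD.
have D0 : 0 <= D.
  have := bD (fun=> 0) (fun=> 0); rewrite normr0 ler01 => /(_ (fun=> isT) (fun=> isT)).
  rewrite big1// => i _; rewrite big1// => j _; by rewrite mul0r mulr0.
set S := sup hform_values.
have S_ub : has_ubound hform_values.
  by exists (\sum_i \sum_j `|b i j|); exact: hform_values_ub.
suff SD : S <= 98 * D.
  move=> N x y x1 y1; apply: le_trans SD; apply: ub_le_sup => //.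
  by exists N, x, y.
suff : S <= 49 * D + 2^-1 * S by lra.
apply: ge_sup.
  exists (hform (fun _ (_ : 'I_0) => 0) (fun _ _ => 0)), 0%N.
  by exists (fun _ _ => 0), (fun _ _ => 0); split => // i; rewrite big_ord0 ler01.
move=> _ [N [x [y [x1 y1 ->]]]].
(* The factor [c] turns a mean over [W] into the unweighted l2 sum used by [hform]. *)
pose W := {ffun 'I_N -> bool}; pose c : R := (Num.sqrt #|{: W}|%:R)^-1.
have W0 : 0 < #|{: W}|%:R :> R by rewrite ltr0n card_signs_gt0.
have c0 : 0 < c by rewrite invr_gt0 sqrtr_gt0.
have c2 : c ^+ 2 = #|{: W}|%:R^-1 by rewrite exprVn sqr_sqrtr// ltW.
have l2mean (F : W -> R) : \sum_w (c * F w) ^+ 2 = mean (fun w => F w ^+ 2).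
  by under eq_bigr do rewrite exprMn c2; rewrite -mulr_sumr mulrC.
pose U H (z : H -> 'I_N -> R) i (w : W) := \sum_k sgn R w k * z i k.
pose UM H z i w := @trunc R 7 (@U H z i w).
have cU H z : l2ball z -> forall i, \sum_w (c * @U H z i w) ^+ 2 <= 1 ^+ 2.
  move=> z1 i; rewrite l2mean expr1n; under eq_mean do rewrite expr2.
  by rewrite mean_rademacherM; under eq_bigr do rewrite -expr2; exact: z1.
have cUM H z : l2ball z -> forall i, \sum_w (c * @UM H z i w) ^+ 2 <= 1 ^+ 2.
  move=> z1 i; apply: le_trans (cU _ _ z1 i); apply: ler_sum => w _.
  by rewrite !exprMn ler_wpM2l ?sqr_ge0// trunc_sqr_le.
have cUt H z : l2ball z ->
    forall i, \sum_w (c * (@U H z i w - @UM H z i w)) ^+ 2 <= 4^-1 ^+ 2.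
  move=> z1 i; rewrite l2mean.
  apply: (@le_trans _ _ ((7 ^+ 2)^-1 * (3 * (\sum_k z i k ^+ 2) ^+ 2))).
    apply: le_trans (ler_wpM2l _ (rademacher_moment4 _)); last by rewrite invr_ge0 exprn_ge0.
    by rewrite -meanZ; apply: le_mean => w; rewrite mulrC; apply: trunc_tail.
  have := z1 i; have : 0 <= \sum_k z i k ^+ 2 by apply: sumr_ge0 => k _; exact: sqr_ge0.
  by move: (\sum_k _) => t t0 t1; rewrite -exprVn; nra.
have -> : hform x y = hform (fun i w => c * U _ x i w) (fun j w => c * U _ y j w).
  apply: eq_bigr => i _; apply: eq_bigr => j _; congr (_ * _).
  rewrite -mean_rademacherM /mean mulr_suml; apply: eq_bigr => w _.
  by rewrite -c2 -/(U _ x i w) -/(U _ y j w); ring.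
(* Keeping the untruncated [U y] in the last term leaves only two remainders, each with one factor
   of norm at most 1 and the other at most 1/4. *)
have -> : hform (fun i w => c * U _ x i w) (fun j w => c * U _ y j w) =
    hform (fun i w => c * UM _ x i w) (fun j w => c * UM _ y j w)
    + hform (fun i w => c * UM _ x i w) (fun j w => c * (U _ y j w - UM _ y j w))
    + hform (fun i w => c * (U _ x i w - UM _ x i w)) (fun j w => c * U _ y j w).
  have split_trunc H z : (fun i w => c * U H z i w) =
      (fun i w => c * UM H z i w + c * (U H z i w - UM H z i w)).
    by apply/funext => i; apply/funext => w; ring.
  by rewrite -hformDr -split_trunc -hformDl -split_trunc.
have q0 : 0 < 4^-1 :> R by rewrite invr_gt0 ltr0n.
have := hform_le_sup ltr01 q0 (cUM _ _ x1) (cUt _ _ y1).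
have := hform_le_sup q0 ltr01 (cUt _ _ x1) (cU _ _ y1).
rewrite -/S.
suff h3 : hform (fun i w => c * UM _ x i w) (fun j w => c * UM _ y j w) <= 49 * D.
  by lra.
have -> : hform (fun i w => c * UM _ x i w) (fun j w => c * UM _ y j w) =
    mean (fun w => 49 * \sum_i \sum_j b i j * ((7^-1 * UM _ x i w) * (7^-1 * UM _ y j w))).
  rewrite meanZ mean_sum mulr_sumr; apply: eq_bigr => i _.
  rewrite mean_sum mulr_sumr; apply: eq_bigr => j _.
  rewrite meanZ mulrCA; congr (_ * _).
  rewrite /mean mulr_suml mulr_sumr; apply: eq_bigr => w _.
  by rewrite -c2; field.
(* For each fixed [w], the truncated sums divided by 7 are scalars admissible in [bD]. *)
rewrite -[leRHS](@mean_const R W) ?card_signs_gt0//; apply: le_mean => w.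
by rewrite ler_wpM2l// bD// => i; rewrite normrM ger0_norm ?invr_ge0//;
  rewrite ler_pdivrMl// mulr1 normr_trunc.
Qed.

End Grothendieck.

(** * Multilinear forms *)

Section MultilinearForms.
Variables (R : realType) (T : finType).

Definition upd (V : Type) (x : T -> V) (i : T) (u : V) : T -> V :=
  fun j => if j == i then u else x j.

Lemma updC (V : Type) (x : T -> V) i j u v :
  i != j -> upd (upd x i u) j v = upd (upd x j v) i u.
Proof.
move=> ij; apply/funext => t; rewrite /upd; case: eqP => // ->.
by rewrite eq_sym (negbTE ij).
Qed.

Definition multilinear_form (V : lmodType R) (b : (T -> V) -> R) : Prop :=
  forall i x (c : R) u v,
    b (upd x i (c *: u + v)) = c * b (upd x i u) + b (upd x i v).

Section Expansion.
Variables (V : lmodType R) (b : (T -> V) -> R).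
Hypothesis bL : multilinear_form b.

Lemma multilinear_form0 i x : b (upd x i 0) = 0.
Proof.
have := bL i x 1 0 0; rewrite scaler0 addr0 mul1r => /eqP.
by rewrite -subr_eq0 opprD addrA subrr sub0r oppr_eq0 => /eqP.
Qed.

Lemma multilinear_formZ i x c u : b (upd x i (c *: u)) = c * b (upd x i u).
Proof. by rewrite -[c *: u]addr0 bL multilinear_form0 addr0. Qed.

Lemma multilinear_form_sum (S : finType) i x (c : S -> R) (u : S -> V) :
  b (upd x i (\sum_s c s *: u s)) = \sum_s c s * b (upd x i (u s)).
Proof.
elim: (index_enum S) => [|s r IH]; first by rewrite !big_nil multilinear_form0.
by rewrite !big_cons bL IH.
Qed.

(* Resampling one coordinate is the involution [(f, s) |-> (f[i := s], f i)]. *)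
Lemma sum_ffun_resample (S : finType) (i : T) (F : {ffun T -> S} -> R) :
  \sum_(f : {ffun T -> S}) \sum_s F (finfun (upd f i s)) = #|S|%:R * \sum_f F f.
Proof.
rewrite pair_big/=.
transitivity (\sum_(q : {ffun T -> S} * S) F q.1); last first.
  rewrite -(pair_bigA _ (fun f (s : S) => F f))/= mulr_sumr.
  by apply: eq_bigr => f _; rewrite sumr_const mulr_natl.
pose h (q : {ffun T -> S} * S) := (finfun (upd q.1 i q.2), q.1 i).
have hK : involutive h.
  move=> [f s]; rewrite /h/= ffunE /upd eqxx; congr (_, _).
  apply/ffunP => t; rewrite ffunE /upd; case: eqP => [->//|/eqP/negbTE ti].
  by rewrite ffunE ti.
by rewrite [RHS](reindex_inj (inv_inj hK)).
Qed.

Lemma multilinear_form_expand (S : finType) (c : T -> S -> R) (u : T -> S -> V) :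
  (0 < #|S|)%N ->
  b (fun t => \sum_s c t s *: u t s) =
  \sum_(f : {ffun T -> S}) (\prod_t c t (f t)) * b (fun t => u t (f t)).
Proof.
move=> S0; set W := fun t => _; set n : R := #|S|%:R.
have n0 : n != 0 by rewrite pnatr_eq0 -lt0n.
(* Only the arguments in [r] are expanded, yet [f] always ranges over all functions. The factor [n]
   per expanded argument makes up for the [n] idle values of [f] at each unexpanded one, so every
   stage has the sum [n ^+ #|T| * b W]. *)
pose G r (f : {ffun T -> S}) := (\prod_(t <- r) (n * c t (f t))) *
  b (fun t => if t \in r then u t (f t) else W t).
have H r : uniq r -> \sum_f G r f = n ^+ #|T| * b W.
  elim: r => [_|i r IH /= /andP[ir /IH <-]].
    rewrite (eq_bigr (fun=> b W)) => [|f _]; last by rewrite /G big_nil mul1r.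
    by rewrite sumr_const card_ffun -natrX mulr_natl.
  apply: (mulfI n0); rewrite -/n -(sum_ffun_resample i) mulr_sumr.
  apply: eq_bigr => f _; rewrite /G.
  have -> : b (fun t => if t \in r then u t (f t) else W t) =
      \sum_s c i s * b (upd (fun t => if t \in r then u t (f t) else W t) i (u i s)).
    rewrite -multilinear_form_sum; congr b; apply/funext => t; rewrite /upd.
    by case: eqP => [->|//]; rewrite (negbTE ir).
  rewrite mulrA mulr_sumr; apply: eq_bigr => s _.
  rewrite big_cons ffunE /upd eqxx.
  have -> : \prod_(t <- r) (n * c t (finfun (upd f i s) t)) = \prod_(t <- r) (n * c t (f t)).
    rewrite !big_seq; apply: eq_bigr => t tr; rewrite ffunE /upd.
    by case: eqP => // ti; rewrite -ti tr in ir.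
  have -> : (fun t => if t \in i :: r then u t (finfun (upd f i s) t) else W t) =
      (fun t => if t == i then u i s else if t \in r then u t (f t) else W t).
    by apply/funext => t; rewrite inE ffunE /upd; case: eqP => [->|].
  by ring.
have := H _ (index_enum_uniq T).
have -> : \sum_f G (index_enum T) f =
   n ^+ #|T| * \sum_(f : {ffun T -> S}) (\prod_t c t (f t)) * b (fun t => u t (f t)).
  rewrite mulr_sumr; apply: eq_bigr => f _; rewrite /G big_split/= prodr_const mulrA.
  congr (_ * b _); apply/funext => t; by rewrite mem_index_enum.
by move/mulfI; rewrite expf_neq0// => /(_ isT).
Qed.

Lemma multilinear_form_diagZ c v : b (fun=> c *: v) = c ^+ #|T| * b (fun=> v).
Proof.
(* Over a one-point index set the expansion reduces to homogeneity. *)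
transitivity (b (fun=> \sum_(s : unit) c *: v)).
  by congr b; apply/funext => t; rewrite sumr_const card_unit.
rewrite (multilinear_form_expand (fun=> fun=> c) (fun=> fun=> v)) ?card_unit//.
by rewrite sumr_const card_ffun card_unit exp1n prodr_const.
Qed.

(* The polarization formula, without the factor [#|T|`!]. *)
Definition polar (u : T -> V) : R :=
  mean (fun w : {ffun T -> bool} =>
    (\prod_i sgn R w i) * b (fun=> \sum_i sgn R w i *: u i)).

(** If [f] misses an index [i], flipping the sign at [i] makes its term odd. If [f] is injective,
    hence a permutation, the signs cancel in pairs. *)
Lemma polarE u : (0 < #|T|)%N ->
  polar u = \sum_(f : {ffun T -> T} | injectiveb f) b (u \o f).
Proof.
move=> T0.
rewrite /polar; under eq_mean do rewrite multilinear_form_expand// mulr_sumr.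
rewrite mean_sum [RHS]big_mkcond; apply: eq_bigr => f _ /=.
under eq_mean do rewrite mulrA mulrC; rewrite meanZ.
case: ifPn => finj; last first.
  suff -> : mean (fun w : {ffun T -> bool} =>
    (\prod_i sgn R w i) * \prod_t sgn R w (f t)) = 0 by rewrite mulr0.
  have /existsP[i /negP fi] : [exists i, i \notin codom f].
    apply: contraR finj; rewrite negb_exists => /forallP fs.
    have /image_injP finj : #|codom f| == #|T|.
      by rewrite eq_cardT ?cardT ?eqxx => [|i] //; have /negPn := fs i.
    by apply/injectiveP => t t'; exact: finj.
  apply: (mean_odd (i := i)) => w.
  have -> : \prod_t sgn R (flip i w) (f t) = \prod_t sgn R w (f t).
    apply: eq_bigr => t _; rewrite sgn_flip; case: eqP => [fti|_]; last by rewrite expr0 mul1r.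
    by case: fi; rewrite -fti codom_f.
  rewrite (bigD1 i)//= [in RHS](bigD1 i)//= sgn_flip eqxx expr1 mulN1r !mulNr.
  congr (- (_ * _ * _)); apply: eq_bigr => j ji.
  by rewrite sgn_flip (negbTE ji) expr0 mul1r.
rewrite (eq_mean (G := fun=> 1)) ?mean_const ?mulr1 ?card_signs_gt0// => w.
rewrite (reindex_inj (injectiveP _ finj))/=.
by rewrite -big_split/= big1// => t _; rewrite -expr2 sgn_sqr.
Qed.

(** Read off from [polarE]: under a permutation [f], [u i] occupies exactly one slot of [b], namely
    [invF finj i]. *)
Lemma polar_multilinear : multilinear_form polar.
Proof.
move=> i x c u v; have T0 : (0 < #|T|)%N by apply/card_gt0P; exists i.
rewrite !polarE// mulr_sumr -big_split; apply: eq_bigr => f /injectiveP finj /=.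
have E w : upd x i w \o f = upd (x \o f) (invF finj i) w.
  apply/funext => t; rewrite /upd /=; congr (if _ then _ else _).
  by rewrite -{1}(f_invF finj i) (inj_eq finj).
by rewrite !E bL.
Qed.

(** On the diagonal [polar] counts [b] once per permutation, and the identity is one of them. *)
Lemma polar_diag v : (0 < #|T|)%N -> `|b (fun=> v)| <= `|polar (fun=> v)|.
Proof.
move=> T0; rewrite polarE// (eq_bigr (fun=> b (fun=> v)))// sumr_const.
rewrite -mulr_natr normrM ler_peMr// normr_nat ler1n.
apply/card_gt0P; exists [ffun t => t]; rewrite unfold_in.
by apply/injectiveP => t t'; rewrite !ffunE.
Qed.

End Expansion.
End MultilinearForms.

(** * Grothendieck's inequality for m-linear forms and polynomials on l_infty^N *)

Section MultilinearGrothendieck.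
Variables (R : realType) (T : finType) (N : nat).
Local Notation V := 'rV[R]_N.

Definition sup_ball (v : V) : Prop := forall a, `|v 0 a| <= 1.

(** A signed sum of [n] points of the sup ball lies in [n] times that ball; homogeneity on the
    diagonal turns this into the factor [n ^+ n]. *)
Lemma polar_bounded (b : (T -> V) -> R) (D : R) :
  multilinear_form b -> (0 < #|T|)%N ->
  (forall v, sup_ball v -> `|b (fun=> v)| <= D) ->
  forall u, (forall t, sup_ball (u t)) -> `|polar b u| <= #|T|%:R ^+ #|T| * D.
Proof.
move=> bL T0 bD u u1; set n : R := #|T|%:R.
have n0 : 0 < n by rewrite ltr0n.
rewrite /polar /mean normrM [`|_^-1|]ger0_norm ?invr_ge0// ler_pdivrMr ?ltr0n ?card_signs_gt0//.
apply: le_trans (ler_norm_sum _ _ _) _.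
rewrite mulrC mulr_natl -sumr_const; apply: ler_sum => w _.
rewrite normrM normr_prod big1 ?mul1r => [|t _]; last exact: normr_sgn.
have -> : \sum_i sgn R w i *: u i = n *: (n^-1 *: \sum_i sgn R w i *: u i).
  by rewrite scalerA divff ?scale1r// lt0r_neq0.
rewrite multilinear_form_diagZ// normrM ger0_norm ?exprn_ge0 ?(ltW n0)//.
rewrite ler_pM2l ?exprn_gt0// bD// => a.
rewrite mxE normrM ger0_norm ?invr_ge0 ?(ltW n0)// ler_pdivrMl// mulr1 summxE.
apply: le_trans (ler_norm_sum _ _ _) _.
rewrite /n -sum1_card natr_sum; apply: ler_sum => t _.
by rewrite mxE normrM normr_sgn mul1r u1.
Qed.

Variables (b : (T -> V) -> R) (D : R).
Hypothesis bL : multilinear_form b.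
Hypothesis bD : forall u, (forall t, sup_ball (u t)) -> `|b u| <= D.

(** Weak l2 norm at most 1 in l_infty^N: the supremum over the dual ball is attained at coordinate
    functionals. *)
Definition l2_columns (k : nat) (z : 'I_k -> V) : Prop :=
  forall a, \sum_j z j 0 a ^+ 2 <= 1.

(* Outside [r] the arguments do not depend on [j].  Adding a coordinate [i] to [r]
   is Grothendieck's inequality for the bilinear form
   [(u, th) |-> \sum_j th j * b (.. u at i ..)] on l_infty^N x l_infty^k. *)
Lemma grothendieck_multilinear_on (k : nat) (r : seq T) : uniq r -> (1 < size r)%N ->
  forall (y : 'I_k -> T -> V) (w : T -> V),
    (forall t, l2_columns (y^~ t)) -> (forall t, sup_ball (w t)) ->
    \sum_j b (fun t => if t \in r then y j t else w t) <= 98 ^+ (size r).-1 * D.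
Proof.
elim: r => [//|i r IH] /= /andP[ir ur] r0 y w y1 w1.
set W := fun j t => if t \in r then y j t else w t.
have expand j u : b (upd (W j) i u) = \sum_a u 0 a * b (upd (W j) i (delta_mx 0 a)).
  by rewrite -(multilinear_form_sum bL) -row_sum_delta.
have -> : \sum_j b (fun t => if t \in i :: r then y j t else w t) =
    \sum_j b (upd (W j) i (y j i)).
  apply: eq_bigr => j _; congr b; apply/funext => t; rewrite /upd inE.
  by case: eqP => [->|].
case: r => [//|k0 [|k1 r]] in IH ir ur r0 W expand *.
  have ik0 : i != k0 by move: ir; rewrite inE.
  (* With two active arguments the Hilbert vectors are the columns of [y] at [i] and at [k0], both
     in l2^k. *)
  pose B a c := b (upd (upd w k0 (delta_mx 0 c)) i (delta_mx 0 a)).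
  have BE u v : b (upd (upd w k0 v) i u) = \sum_a \sum_c B a c * (u 0 a * v 0 c).
    rewrite {1}[u]row_sum_delta (multilinear_form_sum bL); apply: eq_bigr => a _.
    rewrite updC 1?eq_sym// {1}[v]row_sum_delta (multilinear_form_sum bL) mulr_sumr.
    by apply: eq_bigr => c _; rewrite updC// /B; ring.
  have -> : \sum_j b (upd (W j) i (y j i)) =
      hform B (fun a j => y j i 0 a) (fun c j => y j k0 0 c).
    have WE j : W j = upd w k0 (y j k0).
      by apply/funext => t; rewrite /W /upd inE; case: eqP => [->|].
    under eq_bigr do rewrite WE BE.
    rewrite exchange_big/=; apply: eq_bigr => a _; rewrite exchange_big/=.
    by apply: eq_bigr => c _; rewrite mulr_sumr.
  rewrite expr1; apply: grothendieck_inequality => [u v u1 v1|a|c]; [|exact: y1..].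
  have -> : \sum_a \sum_c B a c * (u a * v c) =
      b (upd (upd w k0 (\row_c v c)) i (\row_a u a)).
    by rewrite BE; apply: eq_bigr => a _; apply: eq_bigr => c _; rewrite !mxE.
  apply: le_trans (ler_norm _) (bD _) => t; rewrite /upd.
  by case: eqP => _; [|case: eqP => _ //]; move=> a; rewrite mxE.
have ik0 : i != k0 by apply: contraNneq ir => ->; rewrite mem_head.
(* The second family of vectors is the standard basis of l2^k, so each scalar product picks out one
   entry of a column. *)
pose B a j := b (upd (W j) i (delta_mx 0 a)).
have -> : \sum_j b (upd (W j) i (y j i)) =
    hform B (fun a j => y j i 0 a) (fun j j' => (j == j')%:R).
  under eq_bigr do rewrite expand.
  rewrite exchange_big/=; apply: eq_bigr => a _; apply: eq_bigr => j _.
  rewrite (bigD1 j)//= eqxx mulr1 big1 ?addr0 1?mulrC// => j' jj'.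
  by rewrite eq_sym (negbTE jj') mulr0.
rewrite exprS -mulrA; apply: grothendieck_inequality => [u th u1 th1|a|j]; [|exact: y1|].
  2: rewrite (bigD1 j)//= eqxx expr1n big1 ?addr0// => j' jj'.
  2: by rewrite eq_sym (negbTE jj') expr0n.
pose s : V := \row_a u a.
(* The weight [th j] moves into the active argument [k0], whose columns only shrink, while [i]
   becomes an argument independent of [j]; the induction hypothesis then applies. *)
pose y' j := upd (y j) k0 (th j *: y j k0).
have -> : \sum_a \sum_j B a j * (u a * th j) =
    \sum_j b (fun t => if t \in [:: k0, k1 & r] then y' j t else upd w i s t).
  rewrite exchange_big/=; apply: eq_bigr => j _.
  transitivity (th j * b (upd (W j) i s)).
    by rewrite expand mulr_sumr; apply: eq_bigr => a _; rewrite mxE /B; ring.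
  transitivity (b (upd (upd (W j) i s) k0 (th j *: y j k0))).
    rewrite (multilinear_formZ bL); congr (_ * b _); apply/funext => t.
    by rewrite /upd /W; have [->|//] := eqVneq t k0; rewrite eq_sym (negbTE ik0) mem_head.
  congr b; apply/funext => t; rewrite /upd /W /y' /upd.
  have [->|tk0] := eqVneq t k0; first by rewrite mem_head.
  by have [->|ti] := eqVneq t i; [rewrite (negbTE ir)|].
apply: IH => // [t a|t].
  rewrite /y' /upd; have [tk0|tk0] := eqVneq t k0; last exact: y1.
  apply: le_trans (y1 k0 a); apply: ler_sum => j _; rewrite mxE exprMn ler_piMl ?sqr_ge0//.
  by rewrite -[leLHS]ger0_norm ?sqr_ge0// normrX exprn_ile1.
by rewrite /upd; case: eqP => // _ a; rewrite mxE.
Qed.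

Lemma grothendieck_multilinear (k : nat) (y : 'I_k -> V) : (1 < #|T|)%N ->
  l2_columns y -> \sum_j `|b (fun=> y j)| <= 98 ^+ #|T|.-1 * D.
Proof.
move=> T1 y1; have /card_gt0P[t0 _] : (0 < #|T|)%N by exact: ltnW.
(* Absolute values are removed by putting the sign of each term into the argument [t0]. *)
pose th j := Num.sg (b (fun=> y j)).
pose y' j := upd (fun=> y j) t0 (th j *: y j).
have -> : \sum_j `|b (fun=> y j)| =
    \sum_j b (fun t => if t \in enum T then y' j t else (fun=> 0) t).
  apply: eq_bigr => j _; rewrite normrEsg -/(th j).
  have {1}-> : (fun=> y j) = upd (fun=> y j) t0 (y j) :> (T -> V).
    by apply/funext => t; rewrite /upd; case: eqP.
  rewrite -(multilinear_formZ bL); congr b; apply/funext => t.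
  by rewrite mem_enum.
rewrite cardE; apply: grothendieck_multilinear_on; rewrite ?enum_uniq -?cardE//.
  move=> t a; rewrite /y' /upd; case: eqP => _; last exact: y1.
  apply: le_trans (y1 a); apply: ler_sum => j _; rewrite mxE exprMn ler_piMl ?sqr_ge0//.
  rewrite -[leLHS]ger0_norm ?sqr_ge0// normrX exprn_ile1// normr_sg.
  by case: (_ != _); rewrite ?ler01 ?lexx.
by move=> t a; rewrite mxE normr0.
Qed.

End MultilinearGrothendieck.

Theorem grothendieck_polynomial (R : realType) (T : finType) (N k : nat)
    (b : (T -> 'rV[R]_N) -> R) (D : R) (y : 'I_k -> 'rV[R]_N) :
  multilinear_form b -> (1 < #|T|)%N ->
  (forall v, sup_ball v -> `|b (fun=> v)| <= D) -> l2_columns y ->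
  \sum_j `|b (fun=> y j)| <= 98 ^+ #|T|.-1 * (#|T|%:R ^+ #|T| * D).
Proof.
move=> bL T1 bD y1; have T0 := ltnW T1.
apply: le_trans (grothendieck_multilinear (polar_multilinear bL)
  (polar_bounded bL T0 bD) T1 y1).
by apply: ler_sum => j _; exact: polar_diag.
Qed.

(** * Real and complex scalars *)

Section Scalars.
Variables (R : realType) (s : scalar_kind).
Local Notation K := (scalar_field R s).

Definition emb : R -> K :=
  match s return R -> scalar_field R s with
  | RealScalars => fun x => x
  | ComplexScalars => fun x => x%:C%C
  end.

(* The imaginary unit, or [0] when the scalars are real. *)
Definition imu : K :=
  match s return scalar_field R s with
  | RealScalars => 0
  | ComplexScalars => 'i%C
  end.

(** [Re (i z) = - Im z]. For real scalars [imu = 0] makes it vanish, so [scalar_decomp] holds for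
    both fields and case distinctions stay local. *)
Definition impart (z : K) : R := - realpart (imu * z).

Lemma embD : {morph emb : x y / x + y}.
Proof. by rewrite /emb; case: s => // x y; rewrite rmorphD. Qed.
Lemma embN : {morph emb : x / - x}.
Proof. by rewrite /emb; case: s => // x; rewrite rmorphN. Qed.
Lemma embM : {morph emb : x y / x * y}.
Proof. by rewrite /emb; case: s => // x y; rewrite rmorphM. Qed.
Lemma emb0 : emb 0 = 0. Proof. by rewrite /emb; case: s. Qed.
Lemma emb1 : emb 1 = 1. Proof. by rewrite /emb; case: s. Qed.

Lemma emb_sum (I : Type) (r : seq I) (F : I -> R) :
  emb (\sum_(i <- r) F i) = \sum_(i <- r) emb (F i).
Proof. exact: (big_morph _ embD emb0). Qed.

Lemma embX n : {morph emb : x / x ^+ n}.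
Proof.
by move=> x; elim: n => [|n IH]; rewrite ?expr0 ?emb1// !exprS embM IH.
Qed.

Lemma ler_emb (x y : R) : (emb x <= emb y) = (x <= y).
Proof. by rewrite /emb; case: s => //; rewrite lecR. Qed.

Lemma ltr_emb (x y : R) : (emb x < emb y) = (x < y).
Proof. by rewrite /emb; case: s => //; rewrite ltcR. Qed.

Lemma realpart_emb : cancel emb (@realpart R s).
Proof. by rewrite /emb /realpart; case: s. Qed.

Lemma emb_realpart (z : K) : 0 <= z -> emb (realpart z) = z.
Proof.
rewrite /emb /realpart; case: s z => // -[a b] /=.
by rewrite lecE/= => /andP[/eqP-> _].
Qed.

Lemma realpartD : {morph @realpart R s : x y / x + y}.
Proof. by rewrite /realpart; case: s => // -[a b] [c d]. Qed.
Lemma realpartN : {morph @realpart R s : x / - x}.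
Proof. by rewrite /realpart; case: s => // -[a b]. Qed.
Lemma realpart_embM (x : R) (z : K) : realpart (emb x * z) = x * realpart z.
Proof. by rewrite /emb /realpart; case: s z => // -[a b]/=; rewrite mul0r subr0. Qed.
Lemma realpart0 : realpart (0 : K) = 0.
Proof. by rewrite -emb0 realpart_emb. Qed.

Lemma scalar_decomp (z : K) : z = emb (realpart z) + imu * emb (impart z).
Proof.
rewrite /impart /emb /realpart /imu; case: s z => /=.
  by move=> z; rewrite !mul0r addr0.
by move=> [a b]; apply/eqP; rewrite eq_complex/=; apply/andP; split; apply/eqP => /=; ring.
Qed.

Lemma realpart_imu_emb (x : R) : realpart (imu * emb x) = 0.
Proof. by rewrite /imu /emb /realpart; case: s => /=; rewrite mul0r// mulr0 subr0. Qed.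

Lemma imu_sqr : imu * imu = -1 \/ imu = 0.
Proof.
rewrite /imu; case: s => /=; [by right|left].
by rewrite -expr2 sqr_i.
Qed.

Section Norm.
Variable V : normedModType K.

Lemma normr_emb (v : V) : `|v| = emb (rnorm v).
Proof. by rewrite emb_realpart. Qed.

Lemma rnorm_ge0 (v : V) : 0 <= rnorm v.
Proof. by rewrite -ler_emb -normr_emb emb0. Qed.

Lemma rnorm0 : rnorm (0 : V) = 0.
Proof. by rewrite /rnorm normr0 realpart0. Qed.

Lemma rnorm_eq0 (v : V) : (rnorm v == 0) = (v == 0).
Proof. by rewrite -[v == 0]normr_eq0 normr_emb -emb0 (can_eq realpart_emb). Qed.

Lemma rnormN (v : V) : rnorm (- v) = rnorm v.
Proof. by rewrite /rnorm normrN. Qed.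

Lemma ler_rnormD (u v : V) : rnorm (u + v) <= rnorm u + rnorm v.
Proof. by rewrite -ler_emb embD -!normr_emb ler_normD. Qed.

Lemma ler_rnorm_sum (I : Type) (r : seq I) (F : I -> V) :
  rnorm (\sum_(i <- r) F i) <= \sum_(i <- r) rnorm (F i).
Proof.
elim: r => [|i r IH]; first by rewrite !big_nil rnorm0.
by rewrite !big_cons (le_trans (ler_rnormD _ _))// lerD2l.
Qed.

End Norm.

Lemma rnormZ (V : normedModType K) (a : K) (v : V) : rnorm (a *: v) = rnorm (a : K^o) * rnorm v.
Proof.
apply: (can_inj (@realpart_emb)); rewrite embM -(normr_emb (a *: v)) -(normr_emb v).
by rewrite normrZ -(@normr_emb K^o a).
Qed.

Lemma rnormM (a b : K) : rnorm (a * b : K^o) = rnorm (a : K^o) * rnorm (b : K^o).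
Proof. exact: (@rnormZ K^o). Qed.

Lemma rnorm_emb (x : R) : rnorm (emb x : K^o) = `|x|.
Proof.
rewrite /rnorm /emb /realpart; case: s => //=.
by rewrite expr0n addr0 sqrtr_sqr.
Qed.

Lemma rnorm1 : rnorm (1 : K^o) = 1.
Proof. by rewrite -emb1 rnorm_emb normr1. Qed.

Lemma rnormX (a : K) n : rnorm (a ^+ n : K^o) = rnorm (a : K^o) ^+ n.
Proof. by elim: n => [|n IH]; rewrite ?expr0 ?rnorm1// !exprS rnormM IH. Qed.

Lemma realpart_le (z : K) : `|realpart z| <= rnorm (z : K^o).
Proof.
rewrite /rnorm /realpart; case: s z => //= -[a b] /=.
by rewrite -sqrtr_sqr ler_wsqrtr// lerDl sqr_ge0.
Qed.

Lemma rnorm_imu : rnorm (imu : K^o) <= 1.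
Proof.
rewrite /rnorm /imu /realpart; case: s => /=; first by rewrite normr0.
by rewrite expr0n add0r expr1n sqrtr1.
Qed.

Lemma impart_le (z : K) : `|impart z| <= rnorm (z : K^o).
Proof.
rewrite /impart normrN (le_trans (realpart_le _))// rnormM.
by rewrite ler_piMl// ?rnorm_imu// (@rnorm_ge0 K^o).
Qed.

Lemma rnorm_phase (z : K) : exists2 t : K, rnorm (t : K^o) <= 1 & t * z = emb (rnorm (z : K^o)).
Proof.
have [->|z0] := eqVneq z 0.
  by exists 0; rewrite ?(rnorm0 K^o)// mul0r emb0.
exists (emb (rnorm (z : K^o)) / z); last by rewrite divfK.
rewrite rnormM rnorm_emb ger0_norm ?rnorm_ge0//.
by rewrite -rnormM divff// rnorm1.
Qed.

End Scalars.
Arguments imu {R s}.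

(** * The Hahn-Banach theorem *)

Section HahnBanach.
Variables (R : realType) (V : lmodType R) (p : V -> R).
Hypothesis pD : forall u v, p (u + v) <= p u + p v.
Hypothesis pZ : forall c u, 0 < c -> p (c *: u) = c * p u.

(* Partial functionals are represented by their graphs; domination by [p] makes
   a linear graph single-valued. *)
Definition dominated_graph (G : set (V * R)) : Prop :=
  [/\ G (0, 0),
      forall c x y, G x -> G y -> G (c *: x.1 + y.1, c * x.2 + y.2)
    & forall x, G x -> x.2 <= p x.1].

(** By subadditivity every [x.2 - p (x.1 - v0)] lies below every [p (y.1 + v0) - y.2]. Any value
    between the two families works at [v0], and the supremum of the lower one is taken. *)
Lemma dominated_graph_extend G v0 : dominated_graph G ->
  exists a : R, dominated_graph
    [set (x.1 + c *: v0, x.2 + c * a) | x in G & c in setT].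
Proof.
move=> [G0 GL Gp].
have GZ c x : G x -> G (c *: x.1, c * x.2).
  by move=> Gx; have := GL c _ _ Gx G0; rewrite !addr0.
pose L := [set x.2 - p (x.1 - v0) | x in G].
have ubL y : G y -> ubound L (p (y.1 + v0) - y.2).
  move=> Gy _ [x Gx <-]; rewrite lerBlDr addrAC lerBrDr.
  have := Gp _ (GL 1 _ _ Gx Gy); rewrite /= scale1r mul1r => /le_trans-> //.
  have -> : x.1 + y.1 = (x.1 - v0) + (y.1 + v0) by rewrite addrACA addNr addr0.
  by rewrite [leRHS]addrC pD.
have L0 : L !=set0 by exists (0 - p (0 - v0)), (0, 0).
exists (sup L); split.
- by exists (0, 0) => //; exists 0; rewrite // scale0r mul0r !addr0.
- move=> c _ _ [x Gx [d _ <-]] [y Gy [e _ <-]].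
  exists (c *: x.1 + y.1, c * x.2 + y.2); first exact: GL.
  exists (c * d + e) => //=; congr (_, _); last by ring.
  by rewrite scalerDr scalerDl scalerA addrACA.
- move=> _ [[u r] Gx [c _ <-]] /=.
  have [c0|c0|<-] := ltgtP 0 c.
  + have ci : 0 < c^-1 by rewrite invr_gt0.
    have : sup L <= p (c^-1 *: u + v0) - c^-1 * r.
      by apply: ge_sup => //; exact: (ubL _ (GZ c^-1 _ Gx)).
    rewrite -(ler_pM2l c0) mulrBr -pZ// scalerDr scalerA mulrA divff ?lt0r_neq0//.
    by rewrite scale1r mul1r lerBrDl.
  + have d0 : 0 < - c by rewrite oppr_gt0.
    have di : 0 < (- c)^-1 by rewrite invr_gt0.
    have : (- c)^-1 * r - p ((- c)^-1 *: u - v0) <= sup L.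
      apply: ub_le_sup; first by exists (p (0 + v0) - 0); exact: (ubL _ G0).
      by exists ((- c)^-1 *: u, (- c)^-1 * r) => //; exact: (GZ _ _ Gx).
    rewrite -(ler_pM2l d0) mulrBr -pZ// scalerBr scalerA mulrA divff ?lt0r_neq0//.
    by rewrite scale1r mul1r scaleNr opprK mulNr; lra.
  + by rewrite scale0r mul0r !addr0; exact: (Gp _ Gx).
Qed.

Theorem hahn_banach (G0 : set (V * R)) : dominated_graph G0 ->
  exists f : V -> R,
    [/\ forall c u v, f (c *: u + v) = c * f u + f v,
        forall u, f u <= p u & forall x, G0 x -> f x.1 = x.2].
Proof.
(* Adjoining [G0] inside [P] makes the union of the empty chain admissible and forces the maximal
   graph to extend [G0]. *)
move=> dG0; pose P A := dominated_graph (A `|` G0).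
have [F FP Ftot|A [dA Amax]] := @Zorn_bigcup (V * R)%type P.
  split; first by right; case: dG0.
    have up X Y c x y : F X -> F Y -> X `<=` Y ->
        (X `|` G0) x -> (Y `|` G0) y ->
        (\bigcup_(Z in F) Z `|` G0) (c *: x.1 + y.1, c * x.2 + y.2) /\
        (\bigcup_(Z in F) Z `|` G0) (c *: y.1 + x.1, c * y.2 + x.2).
      move=> FX FY XY xX yY; have [_ L _] := FP _ FY.
      have xY : (Y `|` G0) x by case: xX => [/XY|]; [left|right].
      have sub z : (Y `|` G0) z -> (\bigcup_(Z in F) Z `|` G0) z.
        by case=> ?; [left; exists Y|right].
      by split; apply: sub; apply: L.
    move=> c x y [[X FX Xx]|G0x] [[Y FY Yy]|G0y].
    - have [XY|YX] := Ftot _ _ FX FY.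
        by have [] := up X Y c x y FX FY XY (or_introl Xx) (or_introl Yy).
      by have [] := up Y X c y x FY FX YX (or_introl Yy) (or_introl Xx).
    - by have [] := up X X c x y FX FX (fun _ => id) (or_introl Xx) (or_intror G0y).
    - by have [] := up Y Y c x y FY FY (fun _ => id) (or_intror G0x) (or_introl Yy).
    - by right; have [_ L _] := dG0; apply: L.
  move=> x [[X FX Xx]|G0x]; last by have [_ _] := dG0; apply.
  by have [_ _] := FP _ FX; apply; left.
set G := A `|` G0 in dA.
have total v : exists r, G (v, r).
  apply: contrapT => nv; have [a] := dominated_graph_extend v dA.
  set G' := [set _ | _ in _ & _ in _] => dG'.
  have GG' : G `<=` G'.
    by move=> [u r] Gu; exists (u, r) => //; exists 0; rewrite // scale0r mul0r !addr0.
  have G'v : G' (v, a).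
    exists (0, 0); first by case: dA.
    by exists 1; rewrite // scale1r mul1r !add0r.
  apply: (Amax G'); last first.
    by rewrite /P (_ : G' `|` G0 = G')//; apply/setUidPl => x G0x; apply: GG'; right.
  split; first by move=> x Ax; apply: GG'; left.
  by move=> /(_ _ G'v) Av; apply: nv; exists a; left.
have [f fG] := choice total; have [G00 GL Gp] := dA.
have p0 : p 0 <= 0 by have := pZ 0 (ltr0n _ 2); rewrite scaler0; lra.
have uniqG u r r' : G (u, r) -> G (u, r') -> r = r'.
  have le r1 r2 : G (u, r1) -> G (u, r2) -> r1 <= r2.
    move=> G1 G2; have := Gp _ (GL (-1) _ _ G2 G1).
    rewrite /= scaleN1r addNr mulN1r addrC => /le_trans/(_ p0).
    by rewrite subr_le0.
  by move=> ? ?; apply/eqP; rewrite eq_le !le.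
exists f; split.
- by move=> c u v; apply: uniqG (fG _) _; exact: (GL _ _ _ (fG u) (fG v)).
- by move=> u; exact: (Gp _ (fG u)).
- by move=> [u r] G0x; apply: uniqG (fG _) _; right.
Qed.

End HahnBanach.

Section Bundling.
Variables (K : pzRingType) (U V : lmodType K) (f : U -> V).
(** The linearity proof is an argument so that a [{linear _ -> _}] structure can be attached to the
    term. *)
Definition bundle_linear & linear f := f.
Hypothesis fL : linear f.
HB.instance Definition _ := GRing.isLinear.Build K U V *:%R (bundle_linear fL) fL.
End Bundling.

Section Realify.
Variables (R : realType) (s : scalar_kind) (X : lmodType (scalar_field R s)).

(** An alias of [X] carrying the real scalar action, on which the real Hahn-Banach theorem can be
    used. *)
Definition realify : Type := X.
HB.instance Definition _ := GRing.Zmodule.on realify.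

Definition real_scale (a : R) (x : realify) : realify := emb s a *: (x : X).

Lemma real_scaleA a b x : real_scale a (real_scale b x) = real_scale (a * b) x.
Proof. by rewrite /real_scale scalerA embM. Qed.
Lemma real_scale1 : left_id 1 real_scale.
Proof. by move=> x; rewrite /real_scale emb1 scale1r. Qed.
Lemma real_scaleDr : right_distributive real_scale +%R.
Proof. by move=> a x y; rewrite /real_scale scalerDr. Qed.
Lemma real_scaleDl x : {morph real_scale^~ x : a b / a + b}.
Proof. by move=> a b; rewrite /real_scale embD scalerDl. Qed.
HB.instance Definition _ := GRing.Zmodule_isLmodule.Build R realify
  real_scaleA real_scale1 real_scaleDr real_scaleDl.
End Realify.

Section LocalStructure.
Variables (R : realType) (s : scalar_kind).
Local Notation K := (scalar_field R s).

Lemma rnorm_coord (n : nat) (v : 'rV[K]_n) a : rnorm (v 0 a : K^o) <= rnorm v.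
Proof.
rewrite -(ler_emb s) -!normr_emb {2}/Num.norm/= mx_normE.
rewrite -num_abs_le//.
by apply/bigmax_geP; right; exists (0, a); rewrite // num_abs_le.
Qed.

Lemma rnorm_rV_le (n : nat) (v : 'rV[K]_n) M : 0 <= M ->
  (forall a, rnorm (v 0 a : K^o) <= M) -> rnorm v <= M.
Proof.
move=> M0 vM; have [->|v0] := eqVneq v 0; first by rewrite rnorm0.
have := @mx_norm_neq0 K _ _ v; rewrite -[mx_norm v]/`|v| normr_eq0 => /(_ v0)[[i a]].
rewrite ord1/= normr_emb (@normr_emb R s K^o) => /(can_inj (@realpart_emb R s)) ->.
exact: vM.
Qed.

(** The lower estimate for [T] bounds the [a]-th coordinate by [C] times the norm on the range. Its
    real part is extended to [X], and the functional is rebuilt from that extension. *)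
Lemma coordinate_functional (X : normedModType K) (n : nat)
    (T : {linear 'rV[K]_n -> X}) (C : R) (a : 'I_n) : 0 <= C ->
  (forall v, rnorm v <= C * rnorm (T v)) ->
  exists t : {linear X -> K^o},
    (forall u, rnorm (t u) <= C * rnorm u) /\ forall v, t (T v) = v 0 a.
Proof.
move=> C0 vT.
pose p (u : realify X) : R := C * rnorm (u : X).
pose G : set (realify X * R) := [set (T v, realpart (v 0 a)) | v in setT].
have dG : dominated_graph p G.
  split.
  - by exists 0 => //; rewrite linear0 mxE realpart0.
  - move=> c _ _ [u _ <-] [v _ <-]; exists (emb s c *: u + v) => //=.
    by rewrite linearP !mxE realpartD realpart_embM.
  - move=> _ [v _ <-] /=; apply: le_trans (vT v).
    apply: le_trans (rnorm_coord v a); apply: le_trans (realpart_le _).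
    exact: ler_norm.
have [||f [fL fp fG]] := hahn_banach _ _ dG.
- by move=> u v; rewrite /p -mulrDr ler_wpM2l// ler_rnormD.
- move=> c u c0; rewrite /p [rnorm _](rnormZ (emb s c)) rnorm_emb gtr0_norm//.
  by rewrite mulrCA.
have fD u v : f (u + v) = f u + f v by have := fL 1 u v; rewrite scale1r mul1r.
have f0 : f 0 = 0 by apply: (addrI (f 0)); rewrite -fD !addr0.
have fZ c (u : X) : f (emb s c *: u) = c * f u by have := fL c u 0; rewrite f0 !addr0.
have fN (u : X) : f (- u) = - f u by apply: (addrI (f u)); rewrite -fD !subrr f0.
(* Bohnenblust-Sobczyk *)
pose phi (u : X) : K^o := emb s (f u) - imu * emb s (f (imu *: u)).
have phiD u v : phi (u + v) = phi u + phi v.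
  by rewrite /phi scalerDr !fD !embD; ring.
have phiZ c u : phi (c *: u) = c * phi u.
  rewrite /phi; move: (realpart c) (impart c) (scalar_decomp c) => x y ->.
  have fE (w : X) : f ((emb s x + imu * emb s y) *: w) = x * f w + y * f (imu *: w).
    by rewrite scalerDl fD fZ (mulrC imu) -scalerA fZ.
  rewrite scalerA (mulrC imu (_ + _)) -scalerA !fE !embD !embM.
  have [i2|i0] := imu_sqr R s.
    rewrite scalerA i2 scaleN1r fN embN.
    transitivity (emb s x * emb s (f u) - imu * imu * (emb s y * emb s (f (imu *: u)))
       - imu * (emb s x * emb s (f (imu *: u)) - emb s y * emb s (f u))); last by ring.
    by rewrite i2; ring.
  by rewrite i0 !scale0r f0 emb0; ring.
have phiL : linear phi by move=> c u v; rewrite phiD phiZ.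
have phi_re u : realpart (phi u) = f u.
  by rewrite /phi realpartD realpartN realpart_imu_emb subr0 realpart_emb.
exists (bundle_linear phiL); split => [u|v] /=.
  (* Multiplying [u] by a phase makes the value of [phi] real, where it equals [f] and is bounded by
     [p]. *)
  have [th th1 thE] := rnorm_phase (phi u).
  rewrite -(realpart_emb s (rnorm (phi u : K^o))) -thE -phiZ phi_re.
  apply: le_trans (fp _) _; rewrite /p ler_wpM2l// rnormZ.
  by rewrite ler_piMl// rnorm_ge0.
have fT w : f (T w) = realpart (w 0 a) by apply: (fG (_, _)); exists w.
rewrite /bundle_linear /phi -linearZ !fT mxE -[realpart (_ * _)]opprK -/(impart _).
by rewrite embN mulrN opprK -scalar_decomp.
Qed.
End LocalStructure.

(** * Local structure of script L_infty spaces *)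

Section LinftyStructure.
Variables (R : realType) (s : scalar_kind).
Local Notation K := (scalar_field R s).

Lemma opnorm_unit_ball (V W : normedModType K) (f : V -> W) (A : R) v :
  (opnorm f <= A%:E)%E -> rnorm v <= 1 -> rnorm (f v) <= A.
Proof.
move=> fA v1; rewrite -lee_fin; apply: le_trans fA.
by apply: ereal_sup_ubound; exists v.
Qed.

Lemma opnorm_bound (V W : normedModType K) (f : {linear V -> W}) (A : R) :
  (opnorm f <= A%:E)%E -> forall v, rnorm (f v) <= A * rnorm v.
Proof.
move=> fA v; have [->|v0] := eqVneq v 0; first by rewrite linear0 !rnorm0 mulr0.
have rv0 : 0 < rnorm v by rewrite lt0r rnorm_eq0 v0 rnorm_ge0.
have := @opnorm_unit_ball _ _ f A (emb s (rnorm v)^-1 *: v) fA.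
rewrite linearZ !rnormZ rnorm_emb ger0_norm ?invr_ge0 ?rnorm_ge0// mulVf ?lt0r_neq0//.
by move=> /(_ (lexx _)); rewrite ler_pdivrMl// mulrC.
Qed.

Lemma inv_opnorm_bound (V W : normedModType K) (f : {linear V -> W}) (B : R) :
  injective f -> (inv_opnorm f <= B%:E)%E -> forall v, rnorm v <= B * rnorm (f v).
Proof.
move=> finj fB v; have [->|v0] := eqVneq v 0; first by rewrite linear0 !rnorm0 mulr0.
have fv0 : 0 < rnorm (f v).
  by rewrite lt0r rnorm_eq0 rnorm_ge0 andbT -(linear0 f) (inj_eq finj).
have : ((rnorm (emb s (rnorm (f v))^-1 *: v))%:E <= B%:E)%E.
  apply: le_trans fB; apply: ereal_sup_ubound; exists (emb s (rnorm (f v))^-1 *: v) => //=.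
  by rewrite linearZ rnormZ rnorm_emb ger0_norm ?invr_ge0 ?rnorm_ge0// mulVf ?lt0r_neq0.
rewrite lee_fin rnormZ rnorm_emb ger0_norm ?invr_ge0 ?rnorm_ge0//.
by rewrite ler_pdivrMl// mulrC.
Qed.

(** The Banach-Mazur distance is an infimum that may not be attained, hence the constant [l + 1].
    Dividing [T] by its norm puts the whole distortion on the inverse. *)
Lemma script_Linfty_local (X : completeNormedModType K) : script_Linfty_space X ->
  exists2 C : R, 1 <= C & forall E : set X, finite_dim_subspace E ->
    exists (n : nat) (T : {linear 'rV[K]_n -> X}),
      [/\ forall v, rnorm (T v) <= rnorm v,
          forall v, rnorm v <= C * rnorm (T v) & E `<=` range T].
Proof.
move=> [l l1 lX]; exists (l + 1); first lra.
move=> E /lX[F [_ EF [n dn]]]; exists n.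
have : (banach_mazur_linfty n F < (l + 1)%:E)%E.
  by apply: le_lt_trans dn _; rewrite lte_fin ltrDl.
move=> /ereal_inf_lt {dn}[_ [T [Tinj TF] <-]] TT.
rewrite -{F}TF in EF.
(* In dimension 0 the norm of [T] vanishes and cannot be divided out. *)
case: n => [|n] in T Tinj TT EF *.
  by exists T; split => // v; rewrite (thinmx0 v) ?linear0 ?rnorm0 ?mulr0//.
pose e : 'rV[K]_n.+1 := const_mx 1.
have e1 : rnorm e <= 1.
  by apply: rnorm_rV_le => // a; rewrite mxE rnorm1.
have e0 : e != 0.
  apply/eqP => /rowP/(_ 0); rewrite !mxE => /eqP; by rewrite oner_eq0.
have Te0 : 0 < rnorm (T e).
  by rewrite lt0r rnorm_eq0 rnorm_ge0 andbT -(linear0 T) (inj_eq Tinj).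
have re0 : 0 < rnorm e by rewrite lt0r rnorm_eq0 e0 rnorm_ge0.
(* Since [0 * +oo = 0] in [\bar R], finiteness of the product gives finite factors only once both
   are known to be positive. *)
have op0 : (0 < opnorm T)%E.
  apply: (@lt_le_trans _ _ (rnorm (T e))%:E); first by rewrite lte_fin.
  by apply: ereal_sup_ubound; exists e.
have inv0 : (0 < inv_opnorm T)%E.
  apply: (@lt_le_trans _ _ (rnorm (emb s (rnorm (T e))^-1 *: e))%:E).
    rewrite lte_fin rnormZ rnorm_emb ger0_norm ?invr_ge0 ?rnorm_ge0//.
    by rewrite mulr_gt0// invr_gt0.
  apply: ereal_sup_ubound; exists (emb s (rnorm (T e))^-1 *: e) => //=.
  by rewrite linearZ rnormZ rnorm_emb ger0_norm ?invr_ge0 ?rnorm_ge0// mulVf ?lt0r_neq0.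
have [A [A0 TA]] : exists A, 0 < A /\ opnorm T = A%:E.
  case: (opnorm T) op0 TT => [A|_|//]; first by rewrite lte_fin => A0; exists A.
  by rewrite gt0_mulye.
have [B [B0 TB]] : exists B, 0 < B /\ inv_opnorm T = B%:E.
  case: (inv_opnorm T) inv0 TT => [B|_|//]; first by rewrite lte_fin => B0; exists B.
  by rewrite gt0_muley.
have AB : A * B < l + 1 by rewrite -lte_fin EFinM -TA -TB.
pose Ti : R := A^-1; have Ti0 : 0 < Ti by rewrite invr_gt0.
exists (emb s Ti \*: T : {linear 'rV[K]_n.+1 -> X}); split => [v|v|x /EF[v _ <-]] /=.
- rewrite rnormZ rnorm_emb gtr0_norm// ler_pdivrMl//.
  by apply: opnorm_bound; rewrite TA.
- have vB : rnorm v <= B * rnorm (T v) by apply: inv_opnorm_bound; rewrite ?TB.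
  rewrite rnormZ rnorm_emb gtr0_norm// mulrA; apply: le_trans vB _.
  by rewrite ler_wpM2r ?rnorm_ge0// ler_pdivlMr// mulrC ltW.
- exists (emb s A *: v) => //=; rewrite linearZ/= scalerA -embM mulVf ?lt0r_neq0//.
  by rewrite emb1 scale1r.
Qed.

Lemma Linfty_coordinates (X : completeNormedModType K) : script_Linfty_space X ->
  exists2 C : R, 1 <= C & forall E : set X, finite_dim_subspace E ->
    exists (n : nat) (T : {linear 'rV[K]_n -> X}) (t : 'I_n -> {linear X -> K^o}),
      [/\ forall v, rnorm (T v) <= rnorm v,
          forall a u, rnorm (t a u) <= C * rnorm u,
          forall a v, t a (T v) = v 0 a & E `<=` range T].
Proof.
move=> /script_Linfty_local[C C1 loc]; exists C => // E /loc[n [T [T1 TC ET]]].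
have [t tP] := choice (fun a => coordinate_functional a (le_trans ler01 C1) TC).
by exists n, T, t; split => // a; have [] := tP a.
Qed.

Lemma independent_family (X : lmodType K) (k : nat) : infinite_dimensional X ->
  exists b : 'I_k -> X, forall a : 'I_k -> K, \sum_i a i *: b i = 0 -> forall i, a i = 0.
Proof.
move=> Xinf; elim: k => [|k [b bfree]]; first by exists (fun=> 0) => a _ [].
have [x xb] : exists x, ~ lspan b x.
  apply/existsNP => bX; apply: Xinf; exists k, b; apply/seteqP; split => // x _.
exists (fun i => oapp b x (unlift ord0 i)) => a.
rewrite big_ord_recl unlift_none/=; under eq_bigr do rewrite liftK/=.
move=> ax; have a0 : a ord0 = 0.
  apply: contrapT => /eqP a0; apply: xb; exists (fun i => - (a ord0)^-1 * a (lift ord0 i)) => //.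
  under eq_bigr do rewrite -scalerA; rewrite -scaler_sumr.
  move/eqP: ax; rewrite addrC addr_eq0 => /eqP ->.
  by rewrite scalerN scaleNr opprK scalerA mulVf// scale1r.
move: ax; rewrite a0 scale0r add0r => /bfree H i.
by case: (unliftP ord0 i) => [j ->|->].
Qed.

(** Forces the copies of l_infty^n in an infinite-dimensional space to have arbitrarily large
    [n]. *)
Lemma free_family_le_dim (X : lmodType K) (k n : nat) (b : 'I_k -> X)
    (T : {linear 'rV[K]_n -> X}) :
  (forall a : 'I_k -> K, \sum_i a i *: b i = 0 -> forall i, a i = 0) ->
  (forall i, range T (b i)) -> (k <= n)%N.
Proof.
move=> bfree bT; have preim i : exists u, T u = b i by have [u _ uE] := bT i; exists u.
have [v vP] := choice preim.
pose M := \matrix_i v i.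
suff : row_free M by rewrite -row_leq_rank => /leq_trans; apply; exact: rank_leq_col.
apply: inj_row_free => a aM; apply/rowP => i; rewrite mxE; apply: bfree.
transitivity (T (a *m M)); last by rewrite aM linear0.
rewrite mulmx_sum_row linear_sum; apply: eq_bigr => j _.
by rewrite linearZ rowK vP.
Qed.
End LinftyStructure.

Lemma sum_powR_le (R : realType) (k : nat) (a : 'I_k -> R) (q : R) :
  1 <= q -> (forall j, 0 <= a j) ->
  (\sum_j a j `^ q) `^ q^-1 <= \sum_j a j.
Proof.
move=> q1 a0; set S := \sum_j a j; have q0 : 0 < q by apply: lt_le_trans q1.
have S0 : 0 <= S by apply: sumr_ge0.
suff H : \sum_j a j `^ q <= S `^ q.
  have -> : S = (S `^ q) `^ q^-1 by rewrite -powRrM mulfV ?lt0r_neq0// powRr1.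
  rewrite ge0_ler_powR ?invr_ge0 ?(ltW q0)// ?nnegrE ?powR_ge0//.
  by apply: sumr_ge0 => j _; exact: powR_ge0.
have powS (x : R) : 0 <= x -> x `^ q = x * x `^ (q - 1).
  rewrite le0r => /orP[/eqP->|x0]; first by rewrite powR0 ?lt0r_neq0// mul0r.
  rewrite -{2}(powRr1 (ltW x0)) -powRD ?(addrC 1) ?subrK//.
  by rewrite (gt_eqF x0) implybT.
rewrite powS// /S mulr_suml; apply: ler_sum => j _; rewrite powS//.
rewrite ler_wpM2l// ge0_ler_powR ?subr_ge0// ?nnegrE//.
by rewrite -/S /S (bigD1 j)//= lerDl sumr_ge0.
Qed.

(** * Weak norms and norm bounds for homogeneous polynomials *)

Section Summing.
Variables (R : realType) (s : scalar_kind) (X : normedModType (scalar_field R s)).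
Local Notation K := (scalar_field R s).

Lemma bounded_functional_continuous (f : {linear X -> K^o}) (C : R) :
  (forall u, rnorm (f u) <= C * rnorm u) -> continuous f.
Proof.
move=> fC; apply/linear_bounded_continuous/linear_boundedP.
exists (emb s C); split.
  by rewrite -[emb s C]subr0 -emb0 -embN -embD realE -emb0 !ler_emb le_total.
move=> r Cr x; rewrite (@normr_emb R s K^o) (le_trans (y := emb s (C * rnorm x)))//.
  by rewrite ler_emb.
by rewrite embM -normr_emb ler_wpM2r// ltW.
Qed.

Lemma weak_norm_ge0 (r : R) (k : nat) (x : 'I_k -> X) : (0 <= weak_norm r x)%E.
Proof.
apply: (@le_trans _ _ ((\sum_(j < k) rnorm (\0%R (x j) : K^o) `^ r) `^ r^-1)%:E).
  by rewrite lee_fin powR_ge0.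
apply: ereal_sup_ubound; exists (\0%R : {linear X -> K^o}) => //; split.
  apply: (bounded_functional_continuous (C := 0)) => u; by rewrite mul0r (rnorm0 K^o).
apply: ge_ereal_sup => _ [v v1 <-]; by rewrite lee_fin (rnorm0 K^o).
Qed.

Lemma weak_norm_functional (k : nat) (x : 'I_k -> X) (W C : R) (t : {linear X -> K^o}) :
  0 < C -> weak_norm 2 x = W%:E -> (forall u, rnorm (t u) <= C * rnorm u) ->
  \sum_j rnorm (t (x j)) ^+ 2 <= (C * W) ^+ 2.
Proof.
move=> C0 xW tC.
pose phi : {linear X -> K^o} := (emb s C^-1 \*: t : {linear X -> K^o}).
have phiE u : rnorm (phi u) = C^-1 * rnorm (t u).
  by rewrite /= rnormM rnorm_emb ger0_norm ?invr_ge0 ?ltW.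
have phi1 u : rnorm (phi u) <= 1 * rnorm u.
  by rewrite phiE mul1r ler_pdivrMl.
have : (((\sum_(j < k) rnorm (phi (x j)) `^ 2) `^ 2^-1)%:E <= W%:E)%E.
  rewrite -xW; apply: ereal_sup_ubound; exists phi => //; split.
    exact: bounded_functional_continuous phi1.
  apply: ge_ereal_sup => _ [v v1 <-]; rewrite lee_fin.
  by apply: le_trans (phi1 v) _; rewrite mul1r.
rewrite lee_fin; set S := \sum_j _ => SW.
have S0 : 0 <= S by apply: sumr_ge0 => j _; exact: powR_ge0.
have : S <= W ^+ 2.
  have -> : S = (S `^ 2^-1) ^+ 2.
    by rewrite -powR_mulrn ?powR_ge0// -powRrM mulVf// powRr1.
  by rewrite lerXn2r ?nnegrE ?powR_ge0// (le_trans _ SW)// powR_ge0.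
have -> : S = C ^- 2 * \sum_j rnorm (t (x j)) ^+ 2.
  rewrite mulr_sumr; apply: eq_bigr => j _; rewrite powR_mulrn ?rnorm_ge0//.
  by rewrite phiE exprMn exprVn.
by rewrite ler_pdivrMl ?exprn_gt0// -exprMn.
Qed.

Lemma multilinear_diagZ (m : nat) (A : ('I_m -> X) -> K^o) (c : K) (x : X) :
  multilinear A -> A (fun=> c *: x) = c ^+ m * A (fun=> x).
Proof.
move=> AL; have H (r : seq 'I_m) : uniq r ->
    A (fun t => if t \in r then c *: x else x) = c ^+ size r * A (fun=> x).
  elim: r => [_|i r IH /= /andP[ir /IH Hr]]; first by rewrite mul1r.
  rewrite exprS -mulrA -Hr.
  have := AL i (fun t => if t \in r then c *: x else x).
  set u := fun v => _ => uL; have uZ v : u (c *: v) = c * u v.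
    have u0 : u 0 = 0.
      by have := uL 1 0 0; rewrite scaler0 addr0 scale1r => /eqP;
      rewrite -subr_eq0 opprD addrA subrr sub0r oppr_eq0 => /eqP.
    by have := uL c v 0; rewrite !addr0 u0 addr0.
  transitivity (u (c *: x)).
    by congr A; apply/funext => t; rewrite inE; case: eqP.
  rewrite uZ; congr (_ * A _); apply/funext => t; case: eqP => [->|//].
  by rewrite (negbTE ir).
have := H _ (enum_uniq 'I_m); rewrite size_enum_ord => <-.
by congr A; apply/funext => t; rewrite mem_enum.
Qed.

Lemma homogeneous_polynomial_bound (m : nat) (P : X -> K^o) : (0 < m)%N ->
  homogeneous_polynomials m X P ->
  exists2 D : R, 0 <= D & forall x, rnorm (P x) <= D * rnorm x ^+ m.
Proof.
move=> m0 [[A AL PA] Pc].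
have PZ c x : P (c *: x) = c ^+ m * P x by rewrite !PA multilinear_diagZ.
have P0 : P 0 = 0 by have := PZ 0 0; rewrite scaler0 expr0n gtn_eqF// mul0r.
have : \forall x \near (0 : X), `|P x| < 1.
  have := Pc 0; rewrite /continuous_at P0 => /cvgr0Pnorm_lt; apply; exact: ltr01.
move=> /nbhs_ballP[e /= e0 eP].
pose d := realpart e; have eE : e = emb s d by rewrite emb_realpart// ltW.
have d0 : 0 < d by rewrite -(ltr_emb s) emb0 -eE.
exists ((2 / d) ^+ m); first by rewrite exprn_ge0// divr_ge0// ltW.
move=> x; have [->|x0] := eqVneq x 0.
  by rewrite P0 !(rnorm0) expr0n gtn_eqF// mulr0.
have rx : 0 < rnorm x by rewrite lt0r rnorm_eq0 x0 rnorm_ge0.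
(* Half the radius, since the ball is open. *)
pose c := d / 2 / rnorm x; have c0 : 0 < c by rewrite !divr_gt0.
have /eP : ball 0 e (emb s c *: x).
  rewrite -ball_normE /= sub0r normrN normr_emb eE ltr_emb.
  rewrite rnormZ rnorm_emb gtr0_norm// divfK ?lt0r_neq0//; lra.
rewrite PZ (@normr_emb R s K^o) -emb1 ltr_emb rnormM rnormX rnorm_emb gtr0_norm// => /ltW H.
rewrite -exprMn.
have -> : 2 / d * rnorm x = c^-1.
  by rewrite /c !invfM !invrK; ring.
by rewrite exprVn -[leRHS]mulr1 ler_pdivlMl ?exprn_gt0.
Qed.

End Summing.

(** * Summability of all polynomials for q >= 1 *)

Section Sufficiency.
Variables (R : realType) (s : scalar_kind).
Local Notation K := (scalar_field R s).

Lemma rnorm_le_re_im (z : K) : rnorm (z : K^o) <= `|realpart z| + `|impart z|.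
Proof.
rewrite {1}(scalar_decomp z) (le_trans (@ler_rnormD R s K^o _ _))//.
by rewrite rnorm_emb lerD2l rnormM rnorm_emb ler_piMl// rnorm_imu.
Qed.

(** Pairs of real coordinates parametrize the scalar ones. For real scalars the second half is
    killed by [imu = 0], so one argument serves both fields. *)
Definition complexify (n : nat) (v : 'rV[R]_(n + n)) : 'rV[K]_n :=
  \row_a (emb s (v 0 (lshift n a)) + imu * emb s (v 0 (rshift n a))).

Lemma complexify_real_linear n c (u v : 'rV[R]_(n + n)) :
  complexify (c *: u + v) = emb s c *: complexify u + complexify v.
Proof. by apply/rowP => a; rewrite !mxE !embD !embM; ring. Qed.

Lemma rnorm_complexify n (v : 'rV[R]_(n + n)) : sup_ball v -> rnorm (complexify v) <= 2.
Proof.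
move=> v1; apply: rnorm_rV_le => // a; rewrite mxE.
rewrite (le_trans (@ler_rnormD R s K^o _ _))// -[leRHS]/(1 + 1).
rewrite lerD ?rnorm_emb ?v1// rnormM rnorm_emb.
by rewrite mulr_ile1 ?rnorm_imu ?v1// (@rnorm_ge0 R s K^o).
Qed.

Definition realify_row (n : nat) (w : 'rV[K]_n) : 'rV[R]_(n + n) :=
  row_mx (\row_a realpart (w 0 a)) (\row_a impart (w 0 a)).

Lemma realify_rowK n : cancel (@realify_row n) (@complexify n).
Proof.
move=> w; apply/rowP => a; rewrite mxE row_mxEl row_mxEr !mxE.
by rewrite -scalar_decomp.
Qed.

(** To be used with [g] equal to [realpart] and to [impart], giving two real forms to which the real
    inequality applies. *)
Lemma realpart_multilinear (m n : nat) (X : lmodType K) (A : ('I_m -> X) -> K^o)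
    (T : {linear 'rV[K]_n -> X}) (g : K -> R) :
  (forall c x y, g (emb s c * x + y) = c * g x + g y) ->
  multilinear A ->
  multilinear_form (fun v : 'I_m -> 'rV[R]_(n + n) => g (A (fun t => T (complexify (v t))))).
Proof.
move=> gL AL i v c u w; rewrite -gL; congr g.
have E z : (fun t => T (complexify (upd v i z t))) =
    (fun t => if t == i then T (complexify z) else T (complexify (v t))).
  by apply/funext => t; rewrite /upd; case: eqP.
by rewrite !E complexify_real_linear linearP (AL i _ (emb s c)).
Qed.

Theorem polynomials_summing (m : nat) (q : R) (X : completeNormedModType K) :
  (2 <= m)%N -> script_Linfty_space X -> 1 <= q ->
  homogeneous_polynomials m X `<=` as_polynomials q 2 m X.
Proof.
move=> m2 XL q1 P Phom; split => //.
have m0 : (0 < m)%N by apply: leq_trans m2.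
have [C C1 coords] := Linfty_coordinates XL.
have C0 : 0 < C by apply: lt_le_trans C1.
have [D D0 PD] := homogeneous_polynomial_bound m0 Phom.
have [[A AL PA] _] := Phom.
(* The factor [m%:R ^+ m] comes from polarization, [2 ^+ m] from [rnorm_complexify]. *)
pose M : R := 98 ^+ m.-1 * (m%:R ^+ m * (D * 2 ^+ m)).
have M0 : 0 <= M by rewrite !mulr_ge0 ?exprn_ge0.
have summing k (x : 'I_k -> X) W : weak_norm 2 x = W%:E ->
    \sum_j rnorm (P (x j)) <= 2 * M * (C * W) ^+ m.
  move=> xW; have [|n [T [t [T1 tC tT xT]]]] := coords (lspan x); first by exists k, x.
  have W0 : 0 <= W by rewrite -lee_fin -xW weak_norm_ge0.
  have preim j : exists w, T w = x j.
    have [|w _ wx] := xT (x j); last by exists w.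
    exists (fun i => (i == j)%:R) => //.
    rewrite (bigD1 j)//= eqxx scale1r big1 ?addr0// => i ij.
    by rewrite (negbTE ij) scale0r.
  have [w wx] := choice preim.
  have wcol a : \sum_j rnorm (w j 0 a : K^o) ^+ 2 <= (C * W) ^+ 2.
    apply: le_trans (weak_norm_functional C0 xW (tC a)).
    by apply: ler_sum => j _; rewrite -wx tT.
  (* Normalization by [C * W] below needs [W] nonzero; if [W = 0], all coordinates of the [x j],
     hence the [x j], vanish. *)
  have [W00|W00] := eqVneq W 0.
    have w0 j : x j = 0.
      rewrite -wx; suff -> : w j = 0 by rewrite linear0.
      apply/rowP => a; rewrite mxE; apply/eqP; rewrite -(@rnorm_eq0 R s K^o).
      rewrite -sqrf_eq0 eq_le sqr_ge0 andbT.
      have := wcol a; rewrite W00 mulr0 expr0n; apply: le_trans.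
      by rewrite (bigD1 j)//= lerDl; apply: sumr_ge0 => i _; exact: sqr_ge0.
    rewrite big1 => [|j _]; first by rewrite !mulr_ge0 ?exprn_ge0 ?mulr_ge0// ltW.
    have := PD (x j); rewrite w0 rnorm0 expr0n gtn_eqF// mulr0 => H.
    by apply/eqP; rewrite eq_le H (@rnorm_ge0 R s K^o).
  have W1 : 0 < C * W by rewrite mulr_gt0// lt0r W00.
  pose y j : 'rV[R]_(n + n) := (C * W)^-1 *: realify_row (w j).
  have y1 : l2_columns y.
    move=> a; rewrite -(@ler_pM2l _ ((C * W) ^+ 2)) ?exprn_gt0// mulr1 mulr_sumr.
    case: (split_ordP a) => b ->; apply: le_trans (wcol b); apply: ler_sum => j _;
      rewrite mxE [X in _ * X <= _]exprMn exprVn mulrA divff ?expf_neq0 ?lt0r_neq0// mul1r.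
    - rewrite row_mxEl mxE -[leLHS]ger0_norm ?sqr_ge0// normrX.
      by rewrite lerXn2r ?nnegrE ?(@rnorm_ge0 R s K^o)// realpart_le.
    - rewrite row_mxEr mxE -[leLHS]ger0_norm ?sqr_ge0// normrX.
      by rewrite lerXn2r ?nnegrE ?(@rnorm_ge0 R s K^o)// impart_le.
  have Py j : P (T (complexify (y j))) = emb s ((C * W) ^- m) * P (x j).
    have -> : complexify (y j) = emb s (C * W)^-1 *: w j.
      have c0 : complexify 0 = 0 :> 'rV[K]_n.
        by apply/rowP => a; rewrite !mxE emb0 mulr0 addr0.
      by rewrite /y -[_ *: _]addr0 complexify_real_linear realify_rowK c0 addr0.
    by rewrite linearZ/= wx !PA multilinear_diagZ// -embX exprVn.
  have bound (g : K -> R) :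
      (forall c x y, g (emb s c * x + y) = c * g x + g y) ->
      (forall z, `|g z| <= rnorm (z : K^o)) ->
      \sum_j `|g (P (x j))| <= M * (C * W) ^+ m.
    move=> gL gle.
    have := @grothendieck_polynomial R 'I_m (n + n) k _ (D * 2 ^+ m) y
      (realpart_multilinear T gL AL).
    rewrite card_ord => /(_ m2).
    have H v : sup_ball v -> `|g (A (fun=> T (complexify v)))| <= D * 2 ^+ m.
      move=> v1; rewrite -PA (le_trans (gle _))// (le_trans (PD _))//.
      rewrite ler_wpM2l// lerXn2r ?nnegrE ?rnorm_ge0// (le_trans (T1 _))//.
      exact: rnorm_complexify.
    move=> /(_ H y1); rewrite -/M -(ler_pM2r (exprn_gt0 m W1)) mulr_suml.
    apply: le_trans; apply: ler_sum => j _; rewrite -PA Py.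
    have g0 : g 0 = 0 by have := gL 1 0 0; rewrite mulr0 addr0; lra.
    rewrite -[_ * P _]addr0 gL g0 addr0 normrM normrV ?unitfE ?expf_neq0 ?lt0r_neq0//.
    rewrite (@ger0_norm _ ((C * W) ^+ m)) ?exprn_ge0 ?(ltW W1)// mulrAC mulVf ?mul1r//.
    by rewrite expf_neq0 ?lt0r_neq0.
  have -> : 2 * M * (C * W) ^+ m = M * (C * W) ^+ m + M * (C * W) ^+ m by ring.
  apply: (@le_trans _ _ (\sum_j `|realpart (P (x j))| + \sum_j `|impart (P (x j))|)).
    by rewrite -big_split; apply: ler_sum => j _; exact: rnorm_le_re_im.
  apply: lerD; apply: bound; last exact: impart_le.
  - by move=> c u v; rewrite realpartD realpart_embM.
  - exact: realpart_le.
  - move=> c u v; rewrite /impart mulrDr realpartD mulrCA realpart_embM; ring.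
(* The [+ 1] keeps the constant positive, so that the case of a weak norm [+oo] is trivial instead
   of giving [0 * +oo = 0]. *)
exists (2 * M * C ^+ m + 1); first by rewrite addr_ge0// !mulr_ge0 ?exprn_ge0// ltW.
move=> k x; have := weak_norm_ge0 2 x; case xW : (weak_norm 2 x) => [W| |//] W0.
  rewrite -EFin_expe -EFinM lee_fin; rewrite lee_fin in W0.
  apply: le_trans (sum_powR_le q1 _) _ => [j|]; first exact: (@rnorm_ge0 R s K^o).
  apply: le_trans (summing _ _ _ xW) _.
  have -> : (2 * M * C ^+ m + 1) * W ^+ m = 2 * M * (C * W) ^+ m + W ^+ m.
    by rewrite exprMn; ring.
  by rewrite lerDl exprn_ge0.
have -> : (+oo ^+ m = +oo :> \bar R)%E.
  case: m m0 {m2 Phom PD A AL PA M M0 summing} => // m _.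
  by elim: m => [|m IH]; rewrite ?expe1// expeS IH mulyy.
rewrite gt0_muley ?leey// lte_fin ltr_wpDl// !mulr_ge0 ?exprn_ge0//.
exact: ltW.
Qed.

End Sufficiency.

(** * A non-summing polynomial for q < 1 *)

(** As [c] at least halves, the intervals of centre [r i] and radius [2 * b * c i] are nested. The
    limit is the supremum of their left ends. *)
Lemma geometric_cauchy_limit (R : realType) (r c : nat -> R) (b : R) : 0 <= b ->
  (forall i, 0 <= c i) -> (forall i, c i.+1 <= c i / 2) ->
  (forall i, `|r i.+1 - r i| <= b * c i) ->
  exists l, forall i, `|l - r i| <= 2 * b * c i.
Proof.
move=> b0 c0 cS rS.
have lo : {homo (fun i => r i - 2 * b * c i) : i j / (i <= j)%N >-> i <= j}.
  apply: homo_leq => [//|? ? ?|i]; first exact: le_trans.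
  have := rS i; rewrite ler_norml => /andP[+ _]; have := ler_wpM2l b0 (cS i); lra.
have up : {homo (fun i => r i + 2 * b * c i) : i j / (i <= j)%N >-> j <= i}.
  apply: homo_leq => [//|? ? ? /[swap]|i]; first exact: le_trans.
  have := rS i; rewrite ler_norml => /andP[_ +]; have := ler_wpM2l b0 (cS i); lra.
have lu i j : r i - 2 * b * c i <= r j + 2 * b * c j.
  apply: le_trans (lo _ _ (leq_maxl i j)) _; apply: le_trans (up _ _ (leq_maxr i j)).
  by have := mulr_ge0 b0 (c0 (maxn i j)); lra.
pose E := [set r i - 2 * b * c i | i in [set: nat]].
exists (sup E) => j; rewrite ler_distl; apply/andP; split.
  apply: ub_le_sup; last by exists j.
  by exists (r 0 + 2 * b * c 0) => _ [i _ <-]; exact: lu.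
by apply: ge_sup => [|_ [i _ <-]]; [exists (r 0 - 2 * b * c 0), 0|exact: lu].
Qed.

Section Forms.
Variables (R : realType) (s : scalar_kind) (X : normedModType (scalar_field R s)).
Local Notation K := (scalar_field R s).
Variable m : nat.
Local Notation form := (('I_m -> X) -> K^o).

Definition bounded_form (B : R) (A : form) : Prop :=
  forall u, rnorm (A u) <= B * \prod_l rnorm (u l).

(** Real and imaginary parts each contribute [2 * b * c i]. *)
Lemma scalar_geometric_limit (z : nat -> K) (c : nat -> R) (b : R) : 0 <= b ->
  (forall i, 0 <= c i) -> (forall i, c i.+1 <= c i / 2) ->
  (forall i, rnorm (z i.+1 - z i : K^o) <= b * c i) ->
  exists l : K, forall i, rnorm (l - z i : K^o) <= 4 * b * c i.
Proof.
move=> b0 c0 cS zS.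
have impartB (x y : K) : impart (x - y) = impart x - impart y.
  by rewrite /impart mulrBr realpartD realpartN; ring.
have [x xP] : exists x, forall i, `|x - realpart (z i)| <= 2 * b * c i.
  apply: geometric_cauchy_limit => // i; apply: le_trans (zS i).
  by rewrite -realpartN -realpartD realpart_le.
have [y yP] : exists y, forall i, `|y - impart (z i)| <= 2 * b * c i.
  apply: geometric_cauchy_limit => // i; apply: le_trans (zS i).
  by rewrite -impartB impart_le.
exists (emb s x + imu * emb s y) => i; rewrite {1}(scalar_decomp (z i)).
have -> : emb s x + imu * emb s y - (emb s (realpart (z i)) + imu * emb s (impart (z i)))
   = emb s (x - realpart (z i)) + imu * emb s (y - impart (z i)).
  by rewrite !embD !embN; ring.
rewrite (le_trans (@ler_rnormD R s K^o _ _))// rnormM !rnorm_emb.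
have : rnorm (imu : K^o) * `|y - impart (z i)| <= `|y - impart (z i)|.
  by rewrite ler_piMl// rnorm_imu.
have := xP i; have := yP i; lra.
Qed.

Lemma bounded_form_diag_continuous (B : R) (A : form) : 0 <= B ->
  multilinear A -> bounded_form B A -> continuous (fun x => A (fun=> x)).
Proof.
(* [rho] bounds the norm of every point within distance 1 of [x]. Arguments are exchanged one at a
   time, and [1 <= rho] allows rounding the remaining product up to [rho ^+ m]. *)
move=> B0 AL AB x; pose rho := rnorm x + 1.
have rho1 : 1 <= rho by rewrite lerDr rnorm_ge0.
have rho0 : 0 < rho by apply: lt_le_trans rho1.
pose Lip := m%:R * (B * rho ^+ m).
have lip y : rnorm (y - x) <= 1 ->
    rnorm (A (fun=> x) - A (fun=> y) : K^o) <= Lip * rnorm (y - x).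
  move=> yx.
  have ry : rnorm y <= rho.
    by rewrite -(subrK x y) (le_trans (ler_rnormD _ _))// addrC lerD2l.
  have rx : rnorm x <= rho by rewrite lerDl.
  suff H (r : seq 'I_m) : uniq r ->
      rnorm (A (fun t => if t \in r then y else x) - A (fun=> x) : K^o) <=
      (size r)%:R * (B * rho ^+ m) * rnorm (y - x).
    have := H _ (enum_uniq 'I_m); rewrite size_enum_ord -(@rnormN R s K^o) opprB.
    have -> : (fun t => if t \in enum 'I_m then y else x) = (fun=> y) => //.
    by apply/funext => t; rewrite mem_enum.
  elim: r => [_|i r IH /= /andP[ir /IH Hr]].
    by rewrite subrr (rnorm0 K^o) !mul0r.
  set u := fun t => if t \in r then y else x.
  have := AL i u 1; set F := fun v => _ => FL.
  have FB : F y = F (y - x) + F x.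
    by have := FL (y - x) x; rewrite !scale1r subrK.
  have -> : A (fun t => if t \in i :: r then y else x) = F y.
    by congr A; apply/funext => t; rewrite inE; case: eqP.
  have Fx : F x = A u.
    by congr A; apply/funext => t; case: eqP => [->|//]; rewrite /u (negbTE ir).
  rewrite FB Fx -addrA (le_trans (@ler_rnormD R s K^o _ _))//.
  rewrite -natr1 mulrDl mulrDl [leLHS]addrC lerD// mul1r.
  apply: le_trans (AB _) _; rewrite -mulrA ler_wpM2l//.
  rewrite (bigD1 i)//= eqxx mulrC ler_wpM2r ?rnorm_ge0//.
  apply: (@le_trans _ _ (\prod_(l < m | l != i) rho)).
    apply: ler_prod => l li; rewrite (negbTE li) rnorm_ge0/= /u.
    by case: ifP.
  rewrite prodr_const ler_weXn2l// -[leqRHS]card_ord; exact: max_card.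
have Lip0 : 0 <= Lip by rewrite !mulr_ge0 ?exprn_ge0 ?(ltW rho0).
apply/cvgrPdist_le => e e0; pose d := realpart e.
have eE : e = emb s d by rewrite emb_realpart// ltW.
have d0 : 0 < d by rewrite -(ltr_emb s) emb0 -eE.
pose h := Num.min 1 (d / (Lip + 1)).
have h0 : 0 < h by rewrite lt_min ltr01 divr_gt0// ltr_wpDl.
near=> y.
have : rnorm (y - x) <= h.
  rewrite -(ler_emb s) -normr_emb distrC.
  near: y; apply: cvgr_dist_le; first exact: cvg_id.
  by rewrite -emb0 ltr_emb.
rewrite le_min => /andP[y1 yd].
rewrite (@normr_emb R s K^o) eE ler_emb (le_trans (lip y y1))//.
move: yd; rewrite ler_pdivlMr ?ltr_wpDl// => yd.
by have := rnorm_ge0 (y - x); nra.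
Unshelve. all: by end_near. Qed.

End Forms.

Section Necessity.
Variables (R : realType) (s : scalar_kind).
Local Notation K := (scalar_field R s).

(** The unit vectors of l_infty^n are even weakly 1-summable: with suitable phases as coordinates of
    [v], [phi (T v)] is the sum of all [|phi (T e_j)|]. *)
Lemma weak_norm_basis (X : normedModType K) (n : nat) (T : {linear 'rV[K]_n -> X}) :
  (forall v, rnorm (T v) <= rnorm v) ->
  (weak_norm 2%R (fun j => T (delta_mx 0%R j)) <= 1)%E.
Proof.
move=> T1; apply: ge_ereal_sup => _ [phi [_ phi1] <-]; rewrite lee_fin.
apply: le_trans (sum_powR_le _ _) _ => [|j|]; [by rewrite ler1n|exact: (@rnorm_ge0 R s K^o)|].
have phase j : exists t : K, rnorm (t : K^o) <= 1 /\
    t * phi (T (delta_mx 0 j)) = emb s (rnorm (phi (T (delta_mx 0 j)))).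
  by have [t] := rnorm_phase (phi (T (delta_mx 0 j))); exists t.
have [th thP] := choice phase.
pose v : 'rV[K]_n := \row_j th j.
have phiv : phi (T v) = emb s (\sum_j rnorm (phi (T (delta_mx 0 j)))).
  rewrite emb_sum {1}[v]row_sum_delta !linear_sum; apply: eq_bigr => j _.
  by rewrite !linearZ mxE; have [_ <-] := thP j.
have := opnorm_bound phi1 (T v); rewrite phiv rnorm_emb ger0_norm; last first.
  by apply: sumr_ge0 => j _; exact: (@rnorm_ge0 R s K^o).
move=> /le_trans; apply; rewrite mul1r (le_trans (T1 v))//.
by apply: rnorm_rV_le => // j; rewrite mxE; have [] := thP j.
Qed.

Lemma biorthogonal_systems (X : completeNormedModType K) :
  infinite_dimensional X -> script_Linfty_space X ->
  exists2 C : R, 1 <= C & forall k : nat, exists n : nat,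
    exists (t : 'I_n -> {linear X -> K^o}) (x : 'I_n -> X),
      [/\ (k <= n)%N, forall i u, rnorm (t i u) <= C * rnorm u,
          forall i j, t i (x j) = (i == j)%:R,
          forall j, rnorm (x j) <= 1 & (weak_norm 2%R x <= 1)%E].
Proof.
move=> Xinf /Linfty_coordinates[C C1 coords]; exists C => // k.
have [b bfree] := independent_family k Xinf.
have [|n [T [t [T1 tC tT bT]]]] := coords (lspan b); first by exists k, b.
exists n, t, (fun j => T (delta_mx 0 j)); split => //.
- apply: (free_family_le_dim bfree) => i; apply: bT.
  exists (fun j => (j == i)%:R) => //.
  rewrite (bigD1 i)//= eqxx scale1r big1 ?addr0// => j ji.
  by rewrite (negbTE ji) scale0r.
- by move=> i j; rewrite tT mxE eqxx.
- move=> j; rewrite (le_trans (T1 _))//; apply: rnorm_rV_le => // a.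
  rewrite mxE eqxx/=; case: (_ == _); first by rewrite rnorm1.
  by rewrite (rnorm0 K^o).
- exact: weak_norm_basis.
Qed.

Section Hump.
Variables (X : completeNormedModType K) (m : nat).
Local Notation form := (('I_m -> X) -> K^o).

Lemma multilinear_add_scale (A B : form) (a : K) :
  multilinear A -> multilinear B -> multilinear (fun u => A u + a * B u).
Proof.
move=> AL BL i u c v w; rewrite (AL i u c v w) (BL i u c v w).
by rewrite -![_ *: _]/(_ * _); ring.
Qed.

Lemma power_sum_form (n : nat) (t : 'I_n -> {linear X -> K^o}) (C : R) : (0 < n)%N ->
  0 <= C -> (forall i u, rnorm (t i u) <= C * rnorm u) ->
  let A : form := fun u => emb s n%:R^-1 * \sum_i \prod_l t i (u l) in
  multilinear A /\ bounded_form (C ^+ m) A.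
Proof.
move=> n0 C0 tC A; split=> [l u c v w|u].
  have E i z : \prod_(l' < m) t i (if l' == l then z else u l') =
      t i z * \prod_(l' < m | l' != l) t i (u l') :> K.
    rewrite (bigD1 l)//= eqxx; congr (_ * _); apply: eq_bigr => l' /negbTE ->//.
  rewrite /A -[_ *: _ in RHS]/(_ * _) mulrCA -mulrDr; congr (_ * _).
  rewrite mulr_sumr -big_split; apply: eq_bigr => i _.
  by rewrite !E linearP -[_ *: _]/(_ * _) mulrDl mulrA.
rewrite /A rnormM rnorm_emb ger0_norm// ler_pdivrMl ?ltr0n//.
apply: le_trans (@ler_rnorm_sum R s K^o _ _ _) _.
rewrite mulr_natl -[X in _ *+ X]card_ord -sumr_const; apply: ler_sum => i _.
have -> : rnorm (\prod_l t i (u l) : K^o) = \prod_l rnorm (t i (u l)).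
  exact: (big_morph (fun z : K => rnorm (z : K^o)) (@rnormM R s) (@rnorm1 R s)).
rewrite -[m in C ^+ m]card_ord -prodr_const -big_split.
by apply: ler_prod => l _; rewrite (@rnorm_ge0 R s K^o)/= tC.
Qed.

Lemma powR_one_sub_unbounded (q y : R) : q < 1 ->
  exists k : nat, forall n, (k <= n)%N -> (0 < n)%N -> y <= n%:R `^ (1 - q).
Proof.
move=> q1; have q0 : 0 < 1 - q by rewrite subr_gt0.
have [k ky] : exists k : nat, (`|y| `^ (1 - q)^-1) <= k%:R.
  by exists (Num.truncn (`|y| `^ (1 - q)^-1)).+1; rewrite ltW// truncnS_gt.
exists k => n kn n0; apply: le_trans (ler_norm y) _.
have -> : `|y| = (`|y| `^ (1 - q)^-1) `^ (1 - q).
  by rewrite -powRrM mulVf ?lt0r_neq0// powRr1.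
rewrite ge0_ler_powR ?nnegrE ?powR_ge0 ?(ltW q0)//.
by apply: le_trans ky _; rewrite ler_nat.
Qed.

Lemma as_polynomials_bound (q : R) (P : X -> K^o) : 0 < q ->
  as_polynomials q 2 m X P ->
  exists L : R, forall k (x : 'I_k -> X), (weak_norm 2%R x <= 1)%E ->
    \sum_j rnorm (P (x j)) `^ q <= L.
Proof.
move=> q0 [_ [L L0 PL]]; exists (L `^ q) => k x x1.
have S0 : 0 <= \sum_j rnorm (P (x j)) `^ q by apply: sumr_ge0 => j _; exact: powR_ge0.
have : (((\sum_(j < k) rnorm (P (x j)) `^ q) `^ q^-1)%:E <= L%:E)%E.
  apply: le_trans (PL k x) _; rewrite -[leRHS]mule1 lee_wpmul2l ?lee_fin//.
  have := weak_norm_ge0 2 x; move: x1; case: (weak_norm 2%R x) => // w.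
  by rewrite !lee_fin -EFin_expe lee_fin => w1 w0; exact: exprn_ile1.
rewrite lee_fin => H.
have -> : \sum_j rnorm (P (x j)) `^ q = ((\sum_j rnorm (P (x j)) `^ q) `^ q^-1) `^ q.
  by rewrite -powRrM mulVf ?lt0r_neq0// powRr1.
by rewrite ge0_ler_powR ?nnegrE ?powR_ge0// ltW.
Qed.

Theorem exponent_ge1 (q : R) : (0 < m)%N -> 0 < q ->
  infinite_dimensional X -> script_Linfty_space X ->
  homogeneous_polynomials m X `<=` as_polynomials q 2 m X -> 1 <= q.
Proof.
move=> m0 q0 Xinf XL all_summing; rewrite leNgt; apply/negP => q1.
have [C C1 sys] := biorthogonal_systems Xinf XL.
have C0 : 0 < C by apply: lt_le_trans C1.
pose CM := C ^+ m; have CM1 : 1 <= CM by rewrite exprn_ege1.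
have CM0 : 0 < CM by apply: lt_le_trans CM1.
pose admissible (A : form) := multilinear A /\ exists2 B, 0 <= B & bounded_form B A.
have diag_hom A : admissible A -> homogeneous_polynomials m X (fun x => A (fun=> x)).
  move=> [AL [B B0 AB]]; split; first by exists A.
  exact: (bounded_form_diag_continuous B0 AL AB).
(* Stated for every [A], with [0] as a dummy for forms that are not admissible, so that [choice]
   yields a function [L] on all forms. *)
have exL A : exists L : R, admissible A -> forall k (x : 'I_k -> X),
    (weak_norm 2%R x <= 1)%E -> \sum_j rnorm (A (fun=> x j)) `^ q <= L.
  have [Aadm|nA] := pselect (admissible A); last by exists 0.
  have [L HL] := as_polynomials_bound q0 (all_summing _ (diag_hom _ Aadm)).
  by exists L => _; exact: HL.
have [L LP] := choice exL.
(* [st] holds the index, the partial sum and the coefficient; [bl] the dimension and form of the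
   next block. The new term has modulus [c / n] at each of [n] points, and the [q]-th powers of a
   third of it must outweigh [L] of the partial sum by the index. *)
pose good (st : nat * form * R) (bl : nat * form) := 0 < st.2 ->
  [/\ (0 < bl.1)%N, multilinear bl.2, bounded_form CM bl.2,
      st.1.1%:R + L st.1.2 <= bl.1%:R * (st.2 / (3 * bl.1%:R)) `^ q
    & exists x : 'I_(bl.1) -> X, [/\ (weak_norm 2%R x <= 1)%E, forall j, rnorm (x j) <= 1
      & forall j, bl.2 (fun=> x j) = emb s bl.1%:R^-1]].
have exnext st : exists bl, good st bl.
  case: st => [[i S] c]; rewrite /good/=.
  (* For [c <= 0] any dummy block is good, which keeps the relation total for [choice]. *)
  have [c0|c0] := ltP 0 c; last by exists (0%N, (fun=> 0)).
  have cq : 0 < (c / 3) `^ q by rewrite powR_gt0// divr_gt0.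
  have [k kP] := powR_one_sub_unbounded ((i%:R + L S) / (c / 3) `^ q) q1.
  have [n [t [x [kn tC tx x1 xw]]]] := sys k.+1.
  have n0 : (0 < n)%N by apply: leq_trans kn.
  have [AL AB] := power_sum_form n0 (ltW C0) tC.
  exists (n, fun u => emb s n%:R^-1 * \sum_i \prod_l t i (u l)) => _; split => //=.
    have nR : 0 < n%:R :> R by rewrite ltr0n.
    have := kP n (ltnW kn) n0; rewrite ler_pdivrMr// => /le_trans; apply.
    have <- : n%:R * n%:R^-1 `^ q = n%:R `^ (1 - q).
      rewrite -powR_inv1 ?(ltW nR)// -powRrM mulN1r -{1}(powRr1 (ltW nR)) -powRD//.
      by rewrite (gt_eqF nR) implybT.
    have -> : c / (3 * n%:R) = c / 3 * n%:R^-1 by rewrite invfM mulrA.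
    rewrite [(_ * n%:R^-1) `^ q]powRM ?divr_ge0 ?invr_ge0 ?(ltW c0) ?(ltW nR)//.
    by rewrite -mulrA (mulrC (n%:R^-1 `^ q)).
  exists x; split => // j.
  rewrite (bigD1 j)//= [X in _ + X]big1 ?addr0 => [|i' ij].
    by rewrite big1 ?mulr1// => l _; rewrite tx eqxx.
  (* As [m] is positive, the product has a factor, and it vanishes. *)
  by rewrite (bigD1 (Ordinal m0))//= tx (negbTE ij) mul0r.
have [next nextP] := choice exnext.
(* [st i] is the partial sum [S i] with the coefficient [c i] of the next block.
   [L (S i)] bounds the sum over the next block's points of the [q]-th powers of
   [S i]; the next [c] is so small that the later terms do not matter there. *)
pose fix st (i : nat) : form * R := if i is j.+1 then
    let bl := next (j, (st j).1, (st j).2) in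
    (fun u => (st j).1 u + emb s (st j).2 * bl.2 u, (st j).2 / (12 * CM * bl.1%:R))
  else (fun=> 0, 1).
pose S i := (st i).1; pose c i := (st i).2.
pose n i := (next (i, S i, c i)).1; pose A i := (next (i, S i, c i)).2.
have SS i : S i.+1 = (fun u => S i u + emb s (c i) * A i u) by [].
have cSE i : c i.+1 = c i / (12 * CM * (n i)%:R) by [].
have cpos i : 0 < c i.
  elim: i => [|i IH]; first exact: ltr01.
  have [n0 _ _ _ _] := nextP (i, S i, c i) IH.
  by rewrite cSE divr_gt0// !mulr_gt0// ltr0n.
have blk i := nextP (i, S i, c i) (cpos i).
have n_gt0 i : 0 < (n i)%:R :> R by rewrite ltr0n; have [] := blk i.
have n_ge1 i : 1 <= (n i)%:R :> R by rewrite ler1n; have [] := blk i.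
have c2 i : c i.+1 <= c i / 2.
  rewrite cSE ler_wpM2l ?(ltW (cpos i))// lef_pV2 ?posrE// ?mulr_gt0//.
  by have := n_ge1 i; nra.
pose pr (u : 'I_m -> X) := \prod_l rnorm (u l).
have pr0 u : 0 <= pr u by apply: prodr_ge0 => l _; exact: rnorm_ge0.
have exQ u : exists z : K, forall i, rnorm (z - S i u : K^o) <= 4 * (CM * pr u) * c i.
  apply: scalar_geometric_limit => //.
  - by rewrite mulr_ge0// ltW.
  - by move=> i; exact: ltW.
  - move=> i; rewrite SS addrC addKr rnormM rnorm_emb gtr0_norm// mulrC.
    by rewrite ler_wpM2r// ?(ltW (cpos i))//; have [_ _ + _ _] := blk i; apply.
have [Q QP] := choice exQ.
have S_adm i : admissible (S i).
  elim: i => [|i [SL [B B0 SB]]].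
    split=> [l u a v w|]; first by rewrite scaler0 addr0.
    by exists 0 => // u; rewrite (rnorm0 K^o) mul0r.
  have [_ AL AB _ _] := blk i; rewrite SS; split; first exact: multilinear_add_scale.
  exists (B + c i * CM) => [|u]; first by rewrite addr_ge0// mulr_ge0 ?ltW.
  rewrite (le_trans (@ler_rnormD R s K^o _ _))// mulrDl lerD ?SB//.
  by rewrite rnormM rnorm_emb gtr0_norm// -mulrA ler_wpM2l ?AB// ltW.
(* Halving gives [c i <= 1 / (i + 1)], so a quantity bounded by [b * c i] for all [i] is at most 0.
   This carries linearity over to the limit [Q]. *)
have c_small a b : 0 <= b -> (forall i, a <= b * c i) -> a <= 0.
  move=> b0 ab; have ci i : c i * i.+1%:R <= 1.
    elim: i => [|i IH]; first by rewrite mulr1.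
    have i0 : 0 <= i%:R :> R by [].
    have H : c i.+1 * (i%:R + 2) <= c i / 2 * (i%:R + 2).
      by rewrite ler_wpM2r ?c2// addr_ge0.
    have := mulr_ge0 (ltW (cpos i)) i0; move: IH H.
    by rewrite -[i.+2%:R]natr1 -[i.+1%:R]natr1; nra.
  rewrite leNgt; apply/negP => a0; pose k := Num.truncn (b / a).
  have kb : b < k.+1%:R * a by rewrite -ltr_pdivrMr// truncnS_gt.
  have := ab k; rewrite -(ler_pM2r (ltr0Sn R k)) -mulrA => H.
  have := ler_wpM2l b0 (ci k); rewrite mulr1 => /(le_trans H).
  by rewrite leNgt mulrC kb.
have Q_adm : admissible Q.
  split.
    move=> l u a v w; set u1 := fun j => _; set u2 := fun j => _; set u3 := fun j => _.
    apply/eqP; rewrite -subr_eq0 -(@rnorm_eq0 R s K^o) eq_le (@rnorm_ge0 R s K^o) andbT.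
    (* As [S i] is multilinear, the defect of [Q] is a combination of three errors [Q - S i]. *)
    apply: (c_small _ (4 * CM * (pr u1 + rnorm (a : K^o) * pr u2 + pr u3))).
      by rewrite !mulr_ge0 ?addr_ge0 ?mulr_ge0 ?(@rnorm_ge0 R s K^o) ?(ltW CM0).
    move=> i; have -> : Q u1 - (a *: Q u2 + Q u3) =
        (Q u1 - S i u1) + (- (a * (Q u2 - S i u2)) + - (Q u3 - S i u3)).
      have [SL _] := S_adm i; rewrite (SL l u a v w) -/u2 -/u3 -![_ *: _]/(_ * _); ring.
    rewrite (le_trans (@ler_rnormD R s K^o _ _))//.
    rewrite (le_trans (lerD (QP _ _) (@ler_rnormD R s K^o _ _)))//.
    rewrite !(@rnormN R s K^o) rnormM.
    have := ler_wpM2l (@rnorm_ge0 R s K^o a) (QP u2 i); have := QP u3 i; lra.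
  exists (4 * CM) => [|u]; first by rewrite mulr_ge0// ltW.
  by have := QP u 0%N; rewrite subr0 mulr1 mulrA.
have Qbound i : i%:R <= L Q.
  have [n0 AL AB big [x [xw x1 Ax]]] := blk i.
  pose d := c i / (n i)%:R; have d0 : 0 < d by rewrite divr_gt0.
  have dS j : (d / 3) `^ q <= rnorm (Q (fun=> x j)) `^ q + rnorm (S i (fun=> x j)) `^ q.
    have tail : rnorm (Q (fun=> x j) - S i.+1 (fun=> x j) : K^o) <= d / 3.
      apply: le_trans (QP _ _) _.
      (* This dictates the divisor [12 * CM * n i] in [st]: 4 from the limit estimate, [CM] from the
         block forms, 3 from the share of [d] allowed to the tail. *)
      have -> : d / 3 = 4 * (CM * 1) * c i.+1.
        by rewrite cSE /d; field; rewrite (lt0r_neq0 (n_gt0 i)) (lt0r_neq0 CM0).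
      rewrite ler_wpM2r ?(ltW (cpos _))// ler_wpM2l// ler_wpM2l ?(ltW CM0)//.
      by rewrite /pr prodr_ile1// => l _; rewrite rnorm_ge0 x1.
    have Ssucc : S i.+1 (fun=> x j) = S i (fun=> x j) + emb s d.
      by rewrite SS /A Ax -embM.
    have : d <= rnorm (Q (fun=> x j)) + (d / 3 + rnorm (S i (fun=> x j))).
      rewrite -[leLHS]ger0_norm ?(ltW d0)// -(rnorm_emb s).
      have -> : emb s d = Q (fun=> x j) +
          (- (Q (fun=> x j) - S i.+1 (fun=> x j)) + - S i (fun=> x j)).
        by rewrite Ssucc; ring.
      rewrite (le_trans (@ler_rnormD R s K^o _ _))// lerD2l.
      by rewrite (le_trans (@ler_rnormD R s K^o _ _))// !(@rnormN R s K^o) lerD2r.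
    (* The tail takes at most a third of [d], so [Q] or [S i] is at least [d / 3] at [x j]; no
       subadditivity of [q]-th powers is needed. *)
    have [dQ _|dQ dle] := leP (d / 3) (rnorm (Q (fun=> x j))).
      rewrite (le_trans (y := rnorm (Q (fun=> x j)) `^ q))// ?lerDl ?powR_ge0//.
      by rewrite ge0_ler_powR ?nnegrE ?(ltW q0)// ?(@rnorm_ge0 R s K^o)// divr_ge0// ltW.
    rewrite (le_trans (y := rnorm (S i (fun=> x j)) `^ q))// ?lerDr ?powR_ge0//.
    rewrite ge0_ler_powR ?nnegrE ?(ltW q0)// ?(@rnorm_ge0 R s K^o)//; last by lra.
    by rewrite divr_ge0// ltW.
  have sumd : (n i)%:R * (d / 3) `^ q <= L Q + L (S i).
    rewrite mulr_natl -[X in _ *+ X]card_ord -sumr_const.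
    apply: le_trans (ler_sum _ (fun j _ => dS j)) _.
    by rewrite big_split lerD// LP.
  have := le_trans big; rewrite /= -/(n i) => /(_ (L Q + L (S i))).
  rewrite lerD2r; apply.
  by move: sumd; rewrite /d -mulrA -invfM (mulrC _ 3).
have := Qbound (Num.truncn (L Q)).+1; rewrite leNgt; case/negP; exact: truncnS_gt.
Qed.

End Hump.
End Necessity.

Theorem corollary4 (R : realType) (s : scalar_kind) (m : nat) (q : R)
    (X : completeNormedModType (scalar_field R s)) :
  (2 <= m)%N ->
  infinite_dimensional X ->
  script_Linfty_space X ->
  0 < q ->
  as_polynomials q 2%:R m X = homogeneous_polynomials m X <-> 1 <= q.
Proof.
move=> m2 Xinf XL q0; split => [asE|q1].
  by apply: (exponent_ge1 (ltnW m2) q0 Xinf XL); rewrite -asE.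
by apply/seteqP; split => [P []//|]; exact: polynomials_summing.
Qed.
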